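(* Let $1\le d\le n$ be integers and let $P$ be a $d\times n$ integer matrix of rank $d$ such that $$P^{\mathsf T}\big(\mathbb{Z}^d\setminus 2\mathbb{Z}^d\big)\subseteq\mathbb{Z}^n\setminus 2\mathbb{Z}^n.$$ Let $a^H:\mathbb{Z}^n\to\mathbb{C}$ be the $n$-dimensional Haar low-pass filter, i.e. $a^H(k)=2^{-n}$ if $k\in\{0,1\}^n$ and $a^H(k)=0$ otherwise. Let $s:=\binom{2^n}{2}=2^{n-1}(2^n-1)$, and let $b_1,\ldots,b_s$ be the filters $2^{-n}(\boldsymbol{\delta}_{\gamma_1}-\boldsymbol{\delta}_{\gamma_2})$ on $\mathbb{Z}^n$, one for each unordered pair $\{\gamma_1,\gamma_2\}$ of distinct points of $\{0,1\}^n$ (the ordering of the two points in each pair being chosen arbitrarily). Let $Pa^H,Pb_1,\ldots,Pb_s$ be the projected filters on $\mathbb{Z}^d$. Then: (1) $\{Pa^H;Pb_1,\ldots,Pb_s\}$ is a $d$-dimensional dyadic tight framelet filter bank, where $Pa^H$ is the box spline refinement filter $a_P$ of the box spline $M_P$, and each high-pass filter $Pb_\ell$ that is not identically zero has exactly two nonzero coefficients, which have opposite signs. (2) Define $\phi,\psi_1,\ldots,\psi_s$ by $$\widehat{\phi}(\xi):=\prod_{j=1}^\infty\widehat{Pa^H}(2^{-j}\xi),\qquad \widehat{\psi_\ell}(\xi):=\widehat{Pb_\ell}(\xi/2)\,\widehat{\phi}(\xi/2),\qquad \xi\in\mathbb{R}^d,\ \ell=1,\ldots,s.$$ Then $\phi,\psi_1,\ldots,\psi_s$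 are compactly supported functions in $L_2(\mathbb{R}^d)$, $\{\phi;\psi_1,\ldots,\psi_s\}$ is a (directional) tight framelet in $L_2(\mathbb{R}^d)$, and $\phi$ is the box spline $M_P$ with direction matrix $P$.
   Context: A (finitely supported) filter on $\mathbb{Z}^m$ is a finitely supported function $a:\mathbb{Z}^m\to\mathbb{C}$. Its Fourier series is $\widehat{a}(\xi):=\sum_{k\in\mathbb{Z}^m}a(k)e^{-ik\cdot\xi}$, $\xi\in\mathbb{R}^m$. For $\gamma\in\mathbb{Z}^m$, $\boldsymbol{\delta}_\gamma$ is the filter with $\boldsymbol{\delta}_\gamma(\gamma)=1$ and $\boldsymbol{\delta}_\gamma(k)=0$ for $k\ne\gamma$; $\boldsymbol{\delta}:=\boldsymbol{\delta}_0$. For functions, the Fourier transform is $\widehat{f}(\xi)=\int_{\mathbb{R}^d}f(x)e^{-ix\cdot\xi}\,dx$, extended to $L_2(\mathbb{R}^d)$ and to tempered distributions in the usual way. Projected filter: for a $d\times n$ integer matrix $P$ and a finitely supported filter $a$ on $\mathbb{Z}^n$, the projected filter $Pa$ on $\mathbb{Z}^d$ is defined by $\widehat{Pa}(\xi):=\widehat{a}(P^{\mathsf T}\xi)$, $\xi\in\mathbb{R}^d$; equivalently $[Pa](j)=\sum_{k\in\mathbb{Z}^n,\,Pk=j}a(k)$ for $j\in\mathbb{Z}^d$. Box spline: for a $d\times n$ real matrix $P$ of rank $d$ ($d\le n$), the box spline $M_P$ with direction matrix $P$ is defined by $$\widehat{M_P}(\xi):=\prod_{k\in P}\frac{1-e^{-ik\cdot\xi}}{ik\cdot\xi},\qquad\xi\in\mathbb{R}^d,$$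 where $k$ runs through all the columns of $P$ (each column counted once, with multiplicity), and a factor is interpreted as $1$ where $k\cdot\xi=0$. When $P$ is an integer matrix, the box spline refinement filter is $a_P:=Pa^H$ with $a^H$ the $n$-dimensional Haar low-pass filter. Tight framelet filter bank: finitely supported filters $\{a;b_1,\ldots,b_s\}$ on $\mathbb{Z}^d$ form a $d$-dimensional dyadic tight framelet filter bank if $$\widehat{a}(\xi)\overline{\widehat{a}(\xi+\pi\omega)}+\sum_{\ell=1}^s\widehat{b_\ell}(\xi)\overline{\widehat{b_\ell}(\xi+\pi\omega)}=\boldsymbol{\delta}(\omega)\qquad\text{for all }\xi\in\mathbb{R}^d,\ \omega\in\{0,1\}^d.$$ The filter $a$ is called the low-pass filter and $b_1,\ldots,b_s$ the high-pass filters. Tight framelet: $\{\phi;\psi_1,\ldots,\psi_s\}\subset L_2(\mathbb{R}^d)$ is a (nonhomogeneous) tight framelet in $L_2(\mathbb{R}^d)$ if for all $f\in L_2(\mathbb{R}^d)$ $$\|f\|_{L_2(\mathbb{R}^d)}^2=\sum_{k\in\mathbb{Z}^d}|\langle f,\phi(\cdot-k)\rangle|^2+\sum_{j=0}^\infty\sum_{\ell=1}^s\sum_{k\in\mathbb{Z}^d}|\langle f,2^{jd/2}\psi_\ell(2^j\cdot-k)\rangle|^2.$$ The word ''directional'' refers only to the property that the (nonzero) high-pass filters have exactly two nonzero coefficients, with opposite signs. *)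

(* Defs.v *)
From HB Require Import structures.
From mathcomp Require Import all_boot all_order all_algebra.
From mathcomp Require Import all_classical all_reals all_analysis.
From mathcomp Require Import complex.
Set Implicit Arguments.
Unset Strict Implicit.
Unset Printing Implicit Defensive.
Import Order.TTheory GRing.Theory Num.Theory.
Import numFieldNormedType.Exports.
Local Open Scope classical_set_scope.
Local Open Scope ring_scope.
Local Open Scope complex_scope.

(* The topology on R[i] is the one of its (R[i]-valued) modulus. *)
HB.instance Definition _ (R : rcfType) := NormedModule.copy R[i] R[i]^o.

Fact measure_cV_display : measure_display. Proof. exact. Qed.

Section measurable_cV.
Context {R : realType}.
Variable m : nat.

Definition coord_cV (i : 'I_m) (x : 'cV[R]_m) : R := x i 0.

Let cV_set0 : g_sigma_preimage coord_cV set0.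
Proof. exact: sigma_algebra0. Qed.

Let cV_setC A : g_sigma_preimage coord_cV A -> g_sigma_preimage coord_cV (~` A).
Proof. exact: sigma_algebraC. Qed.

Let cV_bigcup (F : (set 'cV[R]_m)^nat) :
  (forall i, g_sigma_preimage coord_cV (F i)) ->
  g_sigma_preimage coord_cV (\bigcup_i (F i)).
Proof. exact: sigma_algebra_bigcup. Qed.

(* The Borel sigma-algebra of R^m, as generated by the coordinates. *)
HB.instance Definition _ := @isMeasurable.Build measure_cV_display
  'cV[R]_m (g_sigma_preimage coord_cV) cV_set0 cV_setC cV_bigcup.

End measurable_cV.

Lemma measurable_coord_cV {R : realType} m (i : 'I_m) :
  measurable_fun [set: 'cV[R]_m] (coord_cV i).
Proof.
move=> _ Y mY; rewrite setTI; apply: sub_sigma_algebra => /=.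
rewrite -bigcup_seq/=; exists i => /=; first by rewrite mem_index_enum.
by exists Y => //; rewrite setTI.
Qed.

Lemma measurable_fun_cVP {R : realType} d (T : measurableType d) m
    (f : T -> 'cV[R]_m) :
  (forall i, measurable_fun [set: T] (coord_cV i \o f)) ->
  measurable_fun [set: T] f.
Proof.
move=> mf.
suff prefS : g_sigma_preimage (fun i => coord_cV i \o f) `<=` measurable.
  by move=> _ A mA; apply: prefS; rewrite g_sigma_preimage_comp; exists A.
apply: smallest_sub; first exact: sigma_algebra_measurable.
case: m => [|n] in f mf *; first by rewrite big_ord0.
rewrite -bigcup_mkord_ord; apply: bigcup_sub => i Ii.
by move=> A [B mB <-]; exact: mf.
Qed.

Definition cons_cV {R : realType} m (p : R * 'cV[R]_m) : 'cV[R]_m.+1 :=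
  col_mx p.1%:M p.2.

Definition uncons_cV {R : realType} m (x : 'cV[R]_m.+1) : R * 'cV[R]_m :=
  (x ord0 0, \col_i x (lift ord0 i) 0).

Lemma cons_cV0 {R : realType} m (p : R * 'cV[R]_m) : cons_cV p ord0 0 = p.1.
Proof.
have e : (ord0 : 'I_m.+1) = lshift m (0 : 'I_1) by exact/val_inj.
by rewrite /cons_cV e (@col_mxEu _ 1) mxE eqxx.
Qed.

Lemma cons_cVS {R : realType} m (p : R * 'cV[R]_m) i :
  cons_cV p (lift ord0 i) 0 = p.2 i 0.
Proof.
have e : lift ord0 i = rshift 1 i :> 'I_m.+1 by exact/val_inj.
by rewrite /cons_cV e (@col_mxEd _ 1).
Qed.

Lemma cons_cVK {R : realType} m : cancel (@cons_cV R m) (@uncons_cV R m).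
Proof.
move=> p; rewrite /uncons_cV cons_cV0; case: p => a x; congr pair.
by apply/matrixP => i j; rewrite mxE cons_cVS (ord1 j).
Qed.

Lemma uncons_cVK {R : realType} m : cancel (@uncons_cV R m) (@cons_cV R m).
Proof.
move=> x; apply/matrixP => i j; rewrite (ord1 j).
case: (unliftP ord0 i) => [k ->|->]; first by rewrite cons_cVS mxE.
by rewrite cons_cV0.
Qed.

Lemma measurable_cons_cV {R : realType} m :
  measurable_fun [set: R * 'cV[R]_m] (@cons_cV R m).
Proof.
apply: measurable_fun_cVP => i; case: (unliftP ord0 i) => [k ->|->].
  rewrite (_ : _ \o _ = coord_cV k \o snd); last first.
    by apply/funext => p; rewrite /coord_cV/= cons_cVS.
  by apply: measurableT_comp => //; exact: measurable_coord_cV.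
rewrite (_ : _ \o _ = fst)//.
by apply/funext => p; rewrite /coord_cV/= cons_cV0.
Qed.

Lemma measurable_uncons_cV {R : realType} m :
  measurable_fun [set: 'cV[R]_m.+1] (@uncons_cV R m).
Proof.
apply/measurable_fun_pairP; split; first exact: (measurable_coord_cV ord0).
apply: measurable_fun_cVP => i.
rewrite (_ : _ \o _ = coord_cV (lift ord0 i)); first exact: measurable_coord_cV.
by apply/funext => x; rewrite /coord_cV/= mxE.
Qed.

Section lebesgue_cV.
Local Open Scope ereal_scope.
Context {R : realType}.

Section step.
Variables (m : nat) (mu : {sigma_finite_measure set 'cV[R]_m -> \bar R}).

Definition lebesgue_cVS : set 'cV[R]_m.+1 -> \bar R :=
  pushforward (lebesgue_measure \x mu) (@cons_cV R m).

Let mcons := @measurable_cons_cV R m.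

Let lebesgue_cVS0 : lebesgue_cVS set0 = 0.
Proof. by rewrite /lebesgue_cVS /pushforward preimage_set0 measure0. Qed.

Let lebesgue_cVS_ge0 A : 0 <= lebesgue_cVS A.
Proof. exact: measure_ge0. Qed.

Let lebesgue_cVS_sigma_additive : semi_sigma_additive lebesgue_cVS.
Proof.
pose nu := measure_function_pushforward__canonical__measure_function_Measure
  (lebesgue_measure \x mu) mcons.
exact: (@measure_semi_sigma_additive _ _ _ nu).
Qed.

HB.instance Definition _ := isMeasure.Build _ _ _ lebesgue_cVS
  lebesgue_cVS0 lebesgue_cVS_ge0 lebesgue_cVS_sigma_additive.

Let lebesgue_cVS_sigma_finite : sigma_finite setT lebesgue_cVS.
Proof.
have /sigma_finiteP[F [TF ndF Foo]] := sigma_finiteT (@lebesgue_measure R).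
have /sigma_finiteP[G [TG ndG Goo]] := sigma_finiteT mu.
exists (fun k => (@uncons_cV R m) @^-1` (F k `*` G k)).
  rewrite -preimage_bigcup (_ : \bigcup_k _ = setT) ?preimage_setT//.
  rewrite -setXTT TF TG predeqE => -[x y]; split.
    by move=> [n _ []/= ? ?]; split; exists n.
  move=> [/= [i _ Fix] [k _ Gky]]; exists (maxn i k) => //; split.
  - by move: x Fix; exact/subsetPset/ndF/leq_maxl.
  - by move: y Gky; exact/subsetPset/ndG/leq_maxr.
move=> k; have [mF Fk] := Foo k; have [mG Gk] := Goo k; split.
  rewrite -[X in measurable X]setTI; apply: measurable_uncons_cV => //.
  exact: measurableX.
rewrite /lebesgue_cVS /pushforward -comp_preimage (_ : _ \o _ = id); last first.
  by apply/funext => p; rewrite /= cons_cVK.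
by rewrite preimage_id product_measure1E// lte_mul_pinfty// ge0_fin_numE.
Qed.

HB.instance Definition _ := Measure_isSigmaFinite.Build _ _ _ lebesgue_cVS
  lebesgue_cVS_sigma_finite.

End step.

(* Lebesgue measure on R^m: the m-fold product of lebesgue_measure, R^0 being a
   point of measure 1. *)
Fixpoint lebesgue_cV (m : nat) : {sigma_finite_measure set 'cV[R]_m -> \bar R} :=
  match m with
  | 0 => \d_(0%R : 'cV[R]_0)
  | m'.+1 => lebesgue_cVS (lebesgue_cV m')
  end.

Definition box_cV m (a b : 'I_m -> R) : set 'cV[R]_m :=
  [set x | forall i, x i 0%R \in `[a i, b i]%R].

Lemma measurable_box_cV m (a b : 'I_m -> R) : measurable (box_cV a b).
Proof.
rewrite (_ : box_cV a b =
    \bigcap_i ((@coord_cV R m i) @^-1` [set` `[a i, b i]%R])).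
  apply: fin_bigcap_measurable => // i _.
  by rewrite -[X in measurable X]setTI; exact: measurable_coord_cV.
by apply/seteqP; split => x /= H i; [move=> _; exact: H|exact: H].
Qed.

Lemma lebesgue_cV_box m (a b : 'I_m -> R) : (forall i, a i <= b i)%R ->
  lebesgue_cV m (box_cV a b) = (\prod_(i < m) (b i - a i))%R%:E.
Proof.
elim: m => [|m IH] in a b * => ab.
  by rewrite big_ord0 /= diracE mem_set// => -[].
rewrite big_ord_recl /= /lebesgue_cVS /pushforward.
pose a' i := a (lift ord0 i); pose b' i := b (lift ord0 i).
rewrite (_ : _ @^-1` _ = [set` `[a ord0, b ord0]%R] `*` box_cV a' b').
  rewrite product_measure1E//; last exact: measurable_box_cV.
  rewrite IH; last by move=> i; exact: ab.
  rewrite [X in X * _](lebesgue_measure_itv `[a ord0, b ord0]%R) /= lte_fin.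
  have := ab ord0; rewrite le_eqVlt => /orP[/eqP->|->]; last by rewrite EFinM.
  by rewrite ltxx subrr mul0r mul0e.
apply/seteqP; split => -[t x] /=.
  move=> H; split; first by have := H ord0; rewrite cons_cV0.
  by move=> i; have := H (lift ord0 i); rewrite cons_cVS.
move=> [H1 H2] i; case: (unliftP ord0 i) => [k ->|->].
  by rewrite cons_cVS; exact: H2.
by rewrite cons_cV0.
Qed.

End lebesgue_cV.

Section filters.
Context {R : realType}.

Definition zfilter m := 'cV[int]_m -> R[i].

Definition finitely_supported m (a : zfilter m) : Prop :=
  finite_set [set k | a k != 0].

Definition intcV m (k : 'cV[int]_m) : 'cV[R]_m := map_mx intr k.

Definition dotp m (x y : 'cV[R]_m) : R := \sum_(i < m) x i 0 * y i 0.

Definition expi (t : R) : R[i] := cos t +i* sin t.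

(* [\sum_(k \in A)] ranges over the k in A with a nonzero summand, which are
   finitely many when a is finitely supported; the sum is 0 otherwise. *)
Definition fourier_series m (a : zfilter m) (xi : 'cV[R]_m) : R[i] :=
  \sum_(k \in [set: 'cV[int]_m]) a k * expi (- dotp (intcV k) xi).

Definition delta m (g : 'cV[int]_m) : zfilter m := fun k => (k == g)%:R.

Definition cube01 m : set 'cV[int]_m :=
  [set k | forall i, k i 0 = 0 \/ k i 0 = 1].

Arguments cube01 : clear implicits.

(* Every unordered pair of distinct points of {0,1}^n is {g1 l, g2 l} for exactly
   one l. *)
Definition enumerates_pairs n s (g1 g2 : 'I_s -> 'cV[int]_n) : Prop :=
  (forall l, [/\ cube01 n (g1 l), cube01 n (g2 l) & g1 l != g2 l]) /\
  (forall x y, cube01 n x -> cube01 n y -> x != y ->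
    exists! l, (g1 l, g2 l) = (x, y) \/ (g1 l, g2 l) = (y, x)).

Definition even_lattice m : set 'cV[int]_m :=
  [set (2 : int) *: k | k in [set: 'cV[int]_m]].
Arguments even_lattice : clear implicits.

Definition haar (n : nat) : zfilter n :=
  fun k => if k \in cube01 n then 2 ^- n else 0.
Arguments haar : clear implicits.

Definition edge_filter n (g1 g2 : 'cV[int]_n) : zfilter n :=
  fun k => 2 ^- n * (delta g1 k - delta g2 k).

Definition project d n (P : 'M[int]_(d, n)) (a : zfilter n) : zfilter d :=
  fun j => \sum_(k \in [set k | P *m k = j]) a k.

Definition box_spline_filter d n (P : 'M[int]_(d, n)) : zfilter d :=
  project P (haar n).

Definition tight_framelet_filter_bank d s (a : zfilter d)
    (b : 'I_s -> zfilter d) : Prop :=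
  [/\ finitely_supported a,
      forall l, finitely_supported (b l) &
      forall (xi : 'cV[R]_d) (om : 'cV[int]_d), cube01 d om ->
        let xi' := xi + pi *: intcV om in
        fourier_series a xi * (fourier_series a xi')^* +
        \sum_(l < s) fourier_series (b l) xi * (fourier_series (b l) xi')^*
        = delta 0 om].

(* Exactly two nonzero coefficients, real and of opposite signs: in R[i],
   0 < z means that z is a positive real. *)
Definition directional d (b : zfilter d) : Prop :=
  exists j1 j2, [/\ 0 < b j1, b j2 < 0 &
                    forall j, j != j1 -> j != j2 -> b j = 0].

Lemma intcV_dotp d n (P : 'M[int]_(d, n)) (k : 'cV[int]_n) (xi : 'cV[R]_d) :
  dotp (intcV (P *m k)) xi = dotp (intcV k) ((map_mx intr P)^T *m xi).
Proof.
have dotE m (x y : 'cV[R]_m) : dotp x y = (x^T *m y) 0 0.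
  by rewrite mxE; apply: eq_bigr => i _; rewrite mxE.
by rewrite !dotE /intcV map_mxM trmx_mul mulmxA.
Qed.

Lemma fourier_series_seq m (a : zfilter m) (r : seq 'cV[int]_m) xi :
  uniq r -> (forall k, k \notin r -> a k = 0) ->
  fourier_series a xi = \sum_(k <- r) a k * expi (- dotp (intcV k) xi).
Proof.
move=> ur ar; rewrite /fourier_series (fsbigE r)//.
  by apply: eq_bigl => k; rewrite in_setT.
by move=> k _ /ar ->; rewrite mul0r.
Qed.

Lemma project_seq d n (P : 'M[int]_(d, n)) (a : zfilter n)
    (r : seq 'cV[int]_n) j :
  uniq r -> (forall k, k \notin r -> a k = 0) ->
  project P a j = \sum_(k <- r | P *m k == j) a k.
Proof.
move=> ur ar; rewrite bigfs//; last by move=> k _; exact: ar.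
by apply: eq_fsbigl; apply/seteqP; split=> k /= /eqP.
Qed.

Lemma fourier_series_project d n (P : 'M[int]_(d, n)) (a : zfilter n) :
  finitely_supported a -> forall xi,
  fourier_series (project P a) xi = fourier_series a ((map_mx intr P)^T *m xi).
Proof.
move=> fa xi; pose r := finmap.enum_fset (fset_set [set k | a k != 0]).
have ur : uniq r by exact: finmap.fset_uniq.
have ar k : k \notin r -> a k = 0.
  by rewrite /r in_fset_set// notin_setE/= => /negP/negPn/eqP.
rewrite (fourier_series_seq _ ur ar).
have urP : uniq (undup [seq P *m k | k <- r]) by exact: undup_uniq.
rewrite (fourier_series_seq _ urP); last first.
  move=> j; rewrite mem_undup => jr.
  rewrite (project_seq _ _ ur ar) big_seq_cond.
  rewrite big1// => k /andP[kr /eqP kj]; case/mapP: jr.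
  by exists k.
under eq_bigr => j _ do rewrite (project_seq _ _ ur ar) big_distrl/=.
rewrite (exchange_big_dep xpredT)//= big_seq [RHS]big_seq; apply: eq_bigr => k kr.
rewrite big_mkcond/= (bigD1_seq (P *m k))//=; last first.
  by rewrite mem_undup map_f.
rewrite eqxx big1 ?addr0; first by rewrite -intcV_dotp.
by move=> j /negbTE; rewrite eq_sym => ->.
Qed.

End filters.
Arguments even_lattice : clear implicits.
Arguments cube01 : clear implicits.
Arguments zfilter : clear implicits.
Arguments haar {R} n _.

Section functions.
Context {R : realType}.
Variable d : nat.
Local Notation mu := (@lebesgue_cV R d).
Implicit Types f g : 'cV[R]_d -> R[i].

Definition cmeasurable f : Prop :=
  measurable_fun setT (@complex.Re R \o f) /\
  measurable_fun setT (@complex.Im R \o f).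

Definition cintegrable f : Prop :=
  mu.-integrable setT (EFin \o (@complex.Re R \o f)) /\
  mu.-integrable setT (EFin \o (@complex.Im R \o f)).

Definition cintegral f : R[i] :=
  Rintegral mu setT (@complex.Re R \o f) +i*
  Rintegral mu setT (@complex.Im R \o f).

Definition L2_sqnorm f : \bar R := (\int[mu]_x (Normc.normc (f x) ^+ 2)%:E)%E.

(* An element of L_2 is represented by a Borel function. *)
Definition square_integrable f : Prop :=
  cmeasurable f /\ (L2_sqnorm f < +oo)%E.

Definition inner f g : R[i] := cintegral (fun x => f x * (g x)^*).

Definition fourier f (xi : 'cV[R]_d) : R[i] :=
  cintegral (fun x => f x * expi (- dotp x xi)).

Definition has_fourier f (g : 'cV[R]_d -> R[i]) : Prop :=
  cintegrable f /\ forall xi, fourier f xi = g xi.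

Definition compactly_supported f : Prop :=
  compact (closure [set x | f x != 0]).

Definition box_spline_hat n (P : 'M[R]_(d, n)) (xi : 'cV[R]_d) : R[i] :=
  \prod_(j < n) let t := dotp (col j P) xi in
    if t == 0 then 1 else (1 - expi (- t)) / (0 +i* t).

(* M_P is determined, up to a null set, by its Fourier transform. *)
Definition is_box_spline n (P : 'M[R]_(d, n)) f : Prop :=
  has_fourier f (box_spline_hat P).

Definition dilate_shift f (j : nat) (k : 'cV[int]_d) : 'cV[R]_d -> R[i] :=
  fun x => (2 `^ ((j * d)%:R / 2))%:C * f (2 ^+ j *: x - intcV k).

Definition tight_framelet s (phi : 'cV[R]_d -> R[i])
    (psi : 'I_s -> 'cV[R]_d -> R[i]) : Prop :=
  [/\ square_integrable phi,
      forall l, square_integrable (psi l) &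
      forall f, square_integrable f ->
      L2_sqnorm f =
        (\esum_(k in [set: 'cV[int]_d])
            (Normc.normc (inner f (fun x => phi (x - intcV k))) ^+ 2)%:E +
         \sum_(0 <= j <oo) \sum_(l < s) \esum_(k in [set: 'cV[int]_d])
            (Normc.normc (inner f (dilate_shift (psi l) j k)) ^+ 2)%:E)%E].

End functions.

(* Main.v *)
(* Part (1) is Lagrange's identity: the sum over all pairs of (u_i - u_j)(v_i - v_j)^*
   plus (sum u)(sum v)^* is 2^n sum u_i v_i^*; what remains is a character sum over
   {0,1}^n, nonzero only when P^T omega is even.

   The box spline is built as the density of the image nu of the unit cube under P.
   Halving the cube shows that nu is refinable with mask Pa^H, and the hypothesis on P
   says that each class of Z^d / 2Z^d carries the same mass of Pa^H. So the sum of the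
   integer translates of nu is invariant under dyadic dilations and integer
   translations, hence is Lebesgue measure. This gives at once nu <= Lebesgue, so that
   nu has a density M_P with values in [0,1], and the partition of unity
   sum_k M_P(x - k) = 1. Its Fourier transform and the defining product of the box
   spline satisfy the same refinement equation and tend to 1 along 2^-N xi, so both
   are the infinite product of the masks.

   For the tight framelet, let Q_j(f) = sum_k |<f, 2^(jd/2) M_P(2^j . - k)>|^2. By
   Lagrange's identity the framelet coefficients at level j account exactly for
   Q_(j+1)(f) - Q_j(f). By the partition of unity and Cauchy-Schwarz,
   Q_j(f) <= |f|^2, and the defect |f|^2 - Q_j(f) satisfies the parallelogram law, so
   the functions whose defect tends to 0 form a closed subspace of L2. It contains the
   indicators of boxes, hence everything. *)
Require Import Defs.
From HB Require Import structures.
From mathcomp Require Import all_boot all_order all_algebra.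
From mathcomp Require Import all_classical all_reals all_analysis.
From mathcomp Require Import measurable_realfun.
From mathcomp Require Import complex.
From mathcomp Require Import ring lra zify.
Set Implicit Arguments.
Unset Strict Implicit.
Unset Printing Implicit Defensive.
Import Order.TTheory GRing.Theory Num.Theory.
Import numFieldNormedType.Exports.
Local Open Scope classical_set_scope.
Local Open Scope ring_scope.
Local Open Scope complex_scope.

(** * Binary vectors, parity and pairs *)

(** The energies are handled in the space domain, as sums of non-negative terms; Fourier transforms
    serve to identify the functions. The one arithmetic input is that each class of Z^d modulo 2
    contains P e for exactly 2^(n-d) bit vectors e. It acts twice: it turns the factor 2^-n of the
    halved cube into 2^-d, the scaling of Lebesgue measure, and it makes the constants of successive
    levels fit, (2^j)^d (2^(d-n))^2 2^n 2^(n-d) = (2^(j+1))^d. Since Q_j is quadratic in f,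
    convergence does not pass to sums and limits by linearity. The defect is a non-negative
    quadratic form bounded by |f|^2, so the defect of f + g is at most twice the sum of the defects,
    and this handles both. For the indicator of a box, the translates lying inside the box have
    exact coefficients, and the partition of unity shows that they already account for the volume of
    a slightly smaller box. *)

Definition bitcV n (e : {ffun 'I_n -> bool}) : 'cV[int]_n := \col_i (e i)%:R.

Definition cVbit n (k : 'cV[int]_n) : {ffun 'I_n -> bool} :=
  [ffun i => k i 0 == 1].

Lemma bitcVK n : cancel (@bitcV n) (@cVbit n).
Proof. by move=> e; apply/ffunP => i; rewrite ffunE mxE; case: (e i). Qed.

Lemma cVbitK n (k : 'cV[int]_n) : cube01 n k -> bitcV (cVbit k) = k.
Proof.
move=> k01; apply/matrixP => i j; rewrite (ord1 j) mxE ffunE.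
by case: (k01 i) => ->.
Qed.

Lemma cube01_bitcV n (e : {ffun 'I_n -> bool}) : cube01 n (bitcV e).
Proof. by move=> i; rewrite mxE; case: (e i); [right|left]. Qed.

(** The character (-1)^z, integer-valued so that character sums are computed once in [int] and then
    cast where needed. *)
Definition parity (z : int) : int := if (2 %| z)%Z then 1 else -1.

Lemma parityD x y : parity (x + y) = parity x * parity y.
Proof.
rewrite /parity; case: (boolP (2 %| x)%Z) => hx; case: (boolP (2 %| y)%Z) => hy;
case: (boolP (2 %| x + y)%Z) => hxy; lia.
Qed.

Lemma parity0 : parity 0 = 1. Proof. by rewrite /parity dvdz0. Qed.

Lemma parity_sum I (r : seq I) (F : I -> int) :
  parity (\sum_(i <- r) F i) = \prod_(i <- r) parity (F i).
Proof. by apply: (big_morph _ parityD parity0). Qed.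

Lemma sum_bits_prod (A : comPzRingType) n (f : 'I_n -> A) :
  \sum_(e : {ffun 'I_n -> bool}) \prod_(i < n) (if e i then f i else 1) =
  \prod_(i < n) (1 + f i).
Proof.
transitivity (\prod_(i < n) \sum_(b : bool) (if b then f i else 1)).
  by rewrite bigA_distr_bigA.
by apply: eq_bigr => i _; rewrite big_bool addrC.
Qed.

Lemma even_latticeP n (k : 'cV[int]_n) :
  even_lattice n k <-> forall i, (2 %| k i ord0)%Z.
Proof.
split=> [[q _ <-] i|ke]; first by rewrite mxE dvdz_mulr.
exists (\col_i (k i ord0 %/ 2)%Z) => //.
by apply/matrixP => i j; rewrite (ord1 j) !mxE mulrC divzK.
Qed.

(** A single odd coordinate contributes the factor 1 - 1 = 0. *)
Lemma prod_parity n (k : 'cV[int]_n) :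
  \prod_(i < n) (1 + parity (k i 0)) = 2 ^+ n *+ `[< even_lattice n k >].
Proof.
case: asboolP => [/even_latticeP ke|ke].
  rewrite mulr1n -[X in _ = _ ^+ X]card_ord -prodr_const.
  by apply: eq_bigr => i _; rewrite /parity ke.
have [i /negbTE ki] : exists i, ~~ (2 %| k i ord0)%Z.
  by apply: contrapT => H; apply/ke/even_latticeP => i;
    apply: contrapT => /negP Hi; apply: H; exists i.
by rewrite mulr0n (bigD1 i)//= /parity ki addrN mul0r.
Qed.

(** Orthogonality of the characters of (Z/2)^n: expanding the product of the factors
    [1 + parity (k i 0)] gives one term per bit vector. *)
Lemma sum_bits_parity n (k : 'cV[int]_n) :
  \sum_(e : {ffun 'I_n -> bool}) parity (\sum_i bitcV e i 0 * k i 0) =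
  2 ^+ n *+ `[< even_lattice n k >].
Proof.
rewrite -prod_parity -sum_bits_prod; apply: eq_bigr => e _.
rewrite parity_sum; apply: eq_bigr => i _; rewrite mxE.
by case: (e i); rewrite ?mul1r ?mul0r ?parity0.
Qed.

Lemma sum_mulmx_tr (A : comPzRingType) d n (M : 'M[A]_(d, n)) (x : 'cV[A]_d)
    (y : 'cV[A]_n) :
  \sum_i x i 0 * (M *m y) i 0 = \sum_j (M^T *m x) j 0 * y j 0.
Proof.
under eq_bigr do rewrite mxE big_distrr/=.
rewrite exchange_big/=; apply: eq_bigr => j _.
by rewrite mxE big_distrl/=; apply: eq_bigr => i _; rewrite mxE; ring.
Qed.

Section mod2_counting.
Variables (d n : nat) (P : 'M[int]_(d, n)).
Hypothesis P2 : [set P^T *m k | k in ~` even_lattice d] `<=` ~` even_lattice n.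

Lemma even_lattice_tr k : even_lattice n (P^T *m k) -> even_lattice d k.
Proof.
move=> h; apply: contrapT => hk.
by apply: (P2 _ h); exists k.
Qed.

(** This is how the hypothesis on P is used: modulo 2 the transpose of P has trivial kernel. *)
Lemma even_lattice_tr_bit (w : {ffun 'I_d -> bool}) :
  `[< even_lattice n (P^T *m bitcV w) >] = (w == [ffun=> false]).
Proof.
apply/asboolP/eqP => [/even_lattice_tr/even_latticeP h|->].
  by apply/ffunP => i; have := h i; rewrite mxE ffunE; case: (w i).
apply/even_latticeP => i.
rewrite (_ : bitcV _ = 0) ?mulmx0 ?mxE ?dvdz0//.
by apply/matrixP => ? ?; rewrite !mxE ffunE.
Qed.

(* Sum the characters w |-> parity (w . (p - P e)) of (Z/2)^d over w and e. *)
Lemma card_bits_mod2 (p : 'cV[int]_d) : (d <= n)%N ->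
  \sum_(e : {ffun 'I_n -> bool} | `[< even_lattice d (p - P *m bitcV e) >]) 1
  = 2 ^+ (n - d) :> nat.
Proof.
move=> dn; apply/eqP; rewrite -(eqn_pmul2l (expn_gt0 2 d)) -expnD subnKC//.
rewrite -(eqr_nat int) natrM natrX natr_sum big_mkcond/= natrX big_distrr/=.
transitivity (\sum_(e : {ffun 'I_n -> bool}) \sum_(w : {ffun 'I_d -> bool})
   parity (\sum_i bitcV w i 0 * (p - P *m bitcV e) i 0)
   == 2 ^+ n :> int).
  congr (_ == _); apply: eq_bigr => e _; rewrite sum_bits_parity.
  by case: asboolP => _; rewrite ?mulr1 ?mulr0.
rewrite exchange_big/=.
(* Transposing P turns the sum over [e] into the character sum of P^T w, so only the trivial
   character w = 0 survives. *)
rewrite (eq_bigr (fun w : {ffun 'I_d -> bool} =>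
    parity (\sum_i bitcV w i 0 * p i 0) *
    (2 ^+ n *+ (w == [ffun=> false])))); last first.
  move=> w _; rewrite -even_lattice_tr_bit -sum_bits_parity big_distrr/=.
  apply: eq_bigr => e _; rewrite -parityD.
  have -> : \sum_i bitcV w i 0 * (p - P *m bitcV e) i 0 =
    \sum_i bitcV w i 0 * p i 0 + - \sum_i bitcV w i 0 * (P *m bitcV e) i 0.
    rewrite -sumrB; apply: eq_bigr => i _.
    have -> : (p - P *m bitcV e) i 0 = p i 0 - (P *m bitcV e) i 0 by rewrite !mxE.
    by rewrite mulrBr.
  rewrite !parityD; congr (_ * _).
  rewrite sum_mulmx_tr /parity rpredN.
  by under eq_bigr do rewrite mulrC.
rewrite (bigD1 [ffun=> false])//= eqxx mulr1n [X in _ + X]big1 ?addr0; last first.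
  by move=> w /negbTE ->; rewrite mulr0n mulr0.
rewrite big1 ?parity0 ?mul1r//; last by move=> i _; rewrite mxE ffunE mul0r.
by apply/eqP.
Qed.

End mod2_counting.

Section sum_over_pairs.
Variables (n s : nat) (g1 g2 : 'I_s -> 'cV[int]_n).
Hypothesis gP : enumerates_pairs g1 g2.

(** The diagonal vanishes, and each ordered pair of distinct bit vectors comes from exactly one [l],
    in one of its two orders. Adding both orders removes the dependence on the orientation chosen by
    the enumeration. *)
Lemma sum_pairs (A : nmodType) (F : 'cV[int]_n -> 'cV[int]_n -> A) :
  (forall x, F x x = 0) ->
  \sum_(l < s) (F (g1 l) (g2 l) + F (g2 l) (g1 l)) =
  \sum_(e : {ffun 'I_n -> bool}) \sum_(e' : {ffun 'I_n -> bool})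
    F (bitcV e) (bitcV e').
Proof.
case: gP => g01 gex F0.
rewrite pair_big/= (bigID (fun p => p.1 == p.2))/= [X in _ = X + _]big1 ?add0r; last first.
  by case=> x y /=/eqP ->; rewrite F0.
(* Double counting of the incidences between an index [l] and an ordered pair [p]. *)
pose on l (p : {ffun 'I_n -> bool} * {ffun 'I_n -> bool}) :=
  (p == (cVbit (g1 l), cVbit (g2 l))) || (p == (cVbit (g2 l), cVbit (g1 l))).
transitivity (\sum_(l < s) \sum_(p | (p.1 != p.2) && on l p)
    F (bitcV p.1) (bitcV p.2)).
  apply: eq_bigr => l _; have [c1 c2 c12] := g01 l.
  have c12' : cVbit (g1 l) != cVbit (g2 l).
    by apply: contra c12 => /eqP/(congr1 (@bitcV n)); rewrite !cVbitK// => ->.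
  rewrite (bigD1 (cVbit (g1 l), cVbit (g2 l)))/=; last by rewrite c12' /on eqxx.
  rewrite (bigD1 (cVbit (g2 l), cVbit (g1 l)))/=; last first.
    by rewrite eq_sym c12' /on eqxx orbT/= xpair_eqE negb_and eq_sym c12'.
  rewrite !cVbitK// big1 ?addr0// => p /andP[/andP[/andP[_ onp] /negbTE pa] /negbTE pb].
  by move: onp; rewrite /on pa pb.
rewrite (exchange_big_dep (fun p => p.1 != p.2))/=; last by move=> ? ? _ /andP[].
apply: eq_bigr => -[x y]/= xy.
have [] := gex (bitcV x) (bitcV y) (cube01_bitcV x) (cube01_bitcV y).
  by apply: contra xy => /eqP /(congr1 (@cVbit n)); rewrite !bitcVK => ->.
have onP l : on l (x, y) <->
    (g1 l, g2 l) = (bitcV x, bitcV y) \/ (g1 l, g2 l) = (bitcV y, bitcV x).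
  have [c1 c2 _] := g01 l; rewrite /on; split.
    by move=> /orP[] /eqP[-> ->]; rewrite !cVbitK//; [left|right].
  by move=> [] [-> ->]; rewrite !bitcVK eqxx ?orbT.
move=> l [/onP lP lU]; rewrite (bigD1 l)/=; last by rewrite xy.
rewrite big1 ?addr0// => l' /andP[/andP[_ /onP /lU ->]].
by rewrite eqxx.
Qed.

(** Stated bilinearly, without conjugation, so that it serves both the filter bank, where [v] is a
    conjugated character, and the energies, where [u = v] are real coefficients. *)
Lemma lagrange_pairs (K : numFieldType) (u v : 'cV[int]_n -> K) :
  (\sum_(e : {ffun 'I_n -> bool}) u (bitcV e)) *
  (\sum_(e : {ffun 'I_n -> bool}) v (bitcV e)) +
  \sum_(l < s) (u (g1 l) - u (g2 l)) * (v (g1 l) - v (g2 l)) =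
  2 ^+ n * \sum_(e : {ffun 'I_n -> bool}) u (bitcV e) * v (bitcV e).
Proof.
have two0 : (2 : K) != 0 by rewrite pnatr_eq0.
(* The double sum over ordered pairs meets every unordered pair twice. *)
apply: (mulfI two0); rewrite mulrDr.
have -> : 2 * \sum_(l < s) (u (g1 l) - u (g2 l)) * (v (g1 l) - v (g2 l)) =
  \sum_(e : {ffun 'I_n -> bool}) \sum_(e' : {ffun 'I_n -> bool})
    (u (bitcV e) - u (bitcV e')) * (v (bitcV e) - v (bitcV e')).
  rewrite -(@sum_pairs _ (fun x y => (u x - u y) * (v x - v y))).
    by rewrite big_distrr/=; apply: eq_bigr => l _; ring.
  by move=> x; rewrite subrr mul0r.
pose C := \sum_(e : {ffun 'I_n -> bool}) u (bitcV e) * v (bitcV e).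
pose Su := \sum_(e : {ffun 'I_n -> bool}) u (bitcV e).
pose Sv := \sum_(e : {ffun 'I_n -> bool}) v (bitcV e).
have -> : \sum_(e : {ffun 'I_n -> bool}) \sum_(e' : {ffun 'I_n -> bool})
    (u (bitcV e) - u (bitcV e')) * (v (bitcV e) - v (bitcV e')) =
  \sum_(e : {ffun 'I_n -> bool}) (2 ^+ n * (u (bitcV e) * v (bitcV e))
   + C - u (bitcV e) * Sv - Su * v (bitcV e)).
  apply: eq_bigr => e _.
  rewrite (eq_bigr (fun e' => u (bitcV e) * v (bitcV e)
    + u (bitcV e') * v (bitcV e') - u (bitcV e) * v (bitcV e')
    - u (bitcV e') * v (bitcV e))); last by move=> e' _; ring.
  rewrite !sumrB big_split/= sumr_const -big_distrr/= -big_distrl/=.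
  rewrite card_ffun card_bool card_ord -[_ *+ (_ ^ _)%N]mulr_natl natrX; by [].
rewrite !sumrB big_split/= sumr_const -!big_distrr/= -big_distrl/=.
rewrite card_ffun card_bool card_ord -[_ *+ (_ ^ _)%N]mulr_natl natrX -/C -/Su -/Sv.
by ring.
Qed.

End sum_over_pairs.

Section characters.
Context {R : realType}.

Lemma expi0 : expi (0 : R) = 1.
Proof. by rewrite /expi cos0 sin0. Qed.

Lemma expiD (s t : R) : expi (s + t) = expi s * expi t.
Proof.
by rewrite /expi cosD sinD; apply/eqP; rewrite eq_complex/= eqxx addrC eqxx.
Qed.

Lemma expiN (t : R) : expi (- t) = Num.conj (expi t).
Proof. by rewrite /expi cosN sinN. Qed.

Lemma conjC_2Xn n : Num.conj (2 ^- n : R[i]) = 2 ^- n.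
Proof. by rewrite fmorphV rmorphXn rmorph_nat. Qed.

Lemma expi_sum I (r : seq I) (F : I -> R) :
  expi (\sum_(i <- r) F i) = \prod_(i <- r) expi (F i).
Proof. exact: (big_morph _ expiD expi0). Qed.

Lemma expi_intpi (z : int) : expi (z%:~R * pi : R) = (parity z)%:~R.
Proof.
have H (m : nat) : expi (m%:R * pi : R) = (parity m%:Z)%:~R.
  elim: m => [|m IH]; first by rewrite mul0r expi0 parity0.
  rewrite -natr1 mulrDl mul1r expiD IH -addn1 PoszD parityD intrM; congr (_ * _).
  by rewrite /expi cospi sinpi; apply/eqP; rewrite eq_complex/= oppr0 !eqxx.
case: z => m; first exact: H.
rewrite NegzE mulrNz mulNr expiN H /parity rpredN.
by rewrite rmorph_int.
Qed.

Lemma dotpDr m (x y z : 'cV[R]_m) : dotp x (y + z) = dotp x y + dotp x z.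
Proof. by rewrite /dotp -big_split/=; apply: eq_bigr => i _; rewrite mxE mulrDr. Qed.

Lemma dotpZr m (a : R) (x y : 'cV[R]_m) : dotp x (a *: y) = a * dotp x y.
Proof. by rewrite /dotp big_distrr/=; apply: eq_bigr => i _; rewrite mxE mulrCA. Qed.

Lemma dotpC m (x y : 'cV[R]_m) : dotp x y = dotp y x.
Proof. by apply: eq_bigr => i _; rewrite mulrC. Qed.

Lemma dotpDl m (x y z : 'cV[R]_m) : dotp (x + y) z = dotp x z + dotp y z.
Proof. by rewrite ![dotp _ z]dotpC dotpDr. Qed.

Lemma dotpZl m (a : R) (x y : 'cV[R]_m) : dotp (a *: x) y = a * dotp x y.
Proof. by rewrite ![dotp _ y]dotpC dotpZr. Qed.

Lemma dotp_intcV m (x y : 'cV[int]_m) :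
  dotp (intcV x) (intcV y) = (\sum_i x i 0 * y i 0)%:~R :> R.
Proof.
rewrite rmorph_sum/=; apply: eq_bigr => i _.
by rewrite !mxE rmorphM.
Qed.

End characters.

(** * Projected filters and the filter bank identity *)

Section projected_filters.
Context {R : realType}.
Variables (d n : nat) (P : 'M[int]_(d, n)).

Let bits := [seq bitcV e | e : {ffun 'I_n -> bool}].

Let bits_uniq : uniq bits.
Proof. by rewrite map_inj_uniq ?enum_uniq//; exact: can_inj (@bitcVK n). Qed.

Let haar_bits (k : 'cV[int]_n) : k \notin bits -> haar n k = 0 :> R[i].
Proof.
move=> kb; rewrite /haar ifF//; apply/negbTE; apply: contra kb.
rewrite inE => /cVbitK <-; apply: map_f; by rewrite mem_enum.
Qed.

Lemma finitely_supported_seq m (a : zfilter R m) (r : seq 'cV[int]_m) :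
  (forall k, k \notin r -> a k = 0) -> finitely_supported a.
Proof.
move=> ar; apply: (@sub_finite_set _ _ [set` r]); last exact: finite_seq.
by move=> k /= ak; apply: contraTT ak => /ar ->; rewrite eqxx.
Qed.

Lemma finitely_supported_project (a : zfilter R n) (r : seq 'cV[int]_n) :
  uniq r -> (forall k, k \notin r -> a k = 0) ->
  finitely_supported (project P a).
Proof.
move=> ur ar; apply: (@finitely_supported_seq _ _ [seq P *m k | k <- r]) => j jr.
rewrite (project_seq _ _ ur ar) big_seq_cond big1// => k /andP[kr /eqP kj].
by case/negP: jr; rewrite -kj map_f.
Qed.

Lemma fourier_project_haar (xi : 'cV[R]_d) :
  fourier_series (project P (haar n)) xi =
  2 ^- n * \sum_(e : {ffun 'I_n -> bool})
    expi (- dotp (intcV (P *m bitcV e)) xi).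
Proof.
rewrite fourier_series_project; last exact: (finitely_supported_seq haar_bits).
rewrite (fourier_series_seq _ bits_uniq haar_bits) big_map big_distrr/= big_enum/=.
apply: eq_bigr => e _; rewrite intcV_dotp; congr (_ * _).
by rewrite /haar mem_set//; exact: cube01_bitcV.
Qed.

Variables (u v : 'cV[int]_n).
Hypothesis uv : u != v.

Let edge_uniq : uniq [:: u; v].
Proof. by rewrite /= inE uv. Qed.

Let edge_seq (k : 'cV[int]_n) : k \notin [:: u; v] ->
  edge_filter u v k = 0 :> R[i].
Proof.
rewrite !inE negb_or => /andP[/negbTE ku /negbTE kv].
by rewrite /edge_filter /delta ku kv subrr mulr0.
Qed.

Let edge_u : edge_filter u v u = 2 ^- n :> R[i].
Proof. by rewrite /edge_filter /delta eqxx (negbTE uv) subr0 mulr1. Qed.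

Let edge_v : edge_filter u v v = - 2 ^- n :> R[i].
Proof. by rewrite /edge_filter /delta eqxx eq_sym (negbTE uv) sub0r mulrN1. Qed.

Lemma project_edge : project P (edge_filter u v) =
  fun j => 2 ^- n * (delta (P *m u) j - delta (P *m v) j) :> R[i].
Proof.
apply/funext => j; rewrite (project_seq _ _ edge_uniq edge_seq).
rewrite !big_cons big_nil edge_u edge_v /delta ![j == _]eq_sym.
case: (P *m u == j); case: (P *m v == j);
  rewrite /= ?addr0 ?add0r ?subrr ?subr0 ?sub0r ?oppr0 ?mulr0 ?mulr1 ?mulrN1; reflexivity.
Qed.

Lemma fourier_project_edge (xi : 'cV[R]_d) :
  fourier_series (project P (edge_filter u v)) xi =
  2 ^- n * (expi (- dotp (intcV (P *m u)) xi) - expi (- dotp (intcV (P *m v)) xi)).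
Proof.
rewrite fourier_series_project; last exact: (finitely_supported_seq edge_seq).
rewrite (fourier_series_seq _ edge_uniq edge_seq) !big_cons big_nil.
by rewrite edge_u edge_v !intcV_dotp; ring.
Qed.

(** If P u = P v the two coefficients cancel, so a filter that is nonzero somewhere keeps its two
    points apart. *)
Lemma directional_project_edge :
  (exists j, project P (edge_filter u v) j != 0 :> R[i]) ->
  directional (project P (edge_filter u v) : zfilter R d).
Proof.
rewrite project_edge => -[j]; rewrite /delta => jn0.
have Puv : P *m u != P *m v.
  by apply: contra jn0 => /eqP ->; rewrite subrr mulr0.
have pos : 0 < 2 ^- n :> R[i] by rewrite invr_gt0 exprn_gt0// ltr0n.
exists (P *m u), (P *m v); split.
- by rewrite eqxx (negbTE Puv) subr0 mulr1.
- by rewrite eqxx eq_sym (negbTE Puv) sub0r mulrN1 oppr_lt0.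
- by move=> i /negbTE -> /negbTE ->; rewrite subrr mulr0.
Qed.

Lemma finitely_supported_project_edge :
  finitely_supported (project P (edge_filter u v) : zfilter R d).
Proof. exact: finitely_supported_project edge_uniq edge_seq. Qed.

Lemma finitely_supported_project_haar :
  finitely_supported (project P (haar n) : zfilter R d).
Proof. exact: finitely_supported_project bits_uniq haar_bits. Qed.

End projected_filters.

Lemma tight_filter_bank_project (R : realType) (d n s : nat) (P : 'M[int]_(d, n))
    (g1 g2 : 'I_s -> 'cV[int]_n) :
  [set P^T *m k | k in ~` even_lattice d] `<=` ~` even_lattice n ->
  enumerates_pairs g1 g2 ->
  tight_framelet_filter_bank (project P (haar n) : zfilter R d)
    (fun l => project P (edge_filter (g1 l) (g2 l))).
Proof.
move=> P2 gP; have [g01 _] := gP; split.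
- exact: finitely_supported_project_haar.
- by move=> l; apply: finitely_supported_project_edge; have [] := g01 l.
move=> xi om om01 xi'.
rewrite !fourier_project_haar.
pose E (x : 'cV[R]_d) k := expi (- dotp (intcV (P *m k)) x).
rewrite [X in _ + X](eq_bigr (fun l : 'I_s => 2 ^- n * 2 ^- n *
    ((E xi (g1 l) - E xi (g2 l)) * ((E xi' (g1 l))^* - (E xi' (g2 l))^*)))); last first.
  move=> l _; have [_ _ g12] := g01 l.
  by rewrite !(fourier_project_edge _ g12) rmorphM/= conjC_2Xn rmorphB/= mulrACA.
rewrite rmorphM/= conjC_2Xn mulrACA -big_distrr/= -mulrDr rmorph_sum/=.
rewrite (@lagrange_pairs _ _ _ _ gP _ (E xi) (fun k => Num.conj (E xi' k))).
have n0 : (2 ^+ n : R[i]) != 0 by rewrite expf_neq0// pnatr_eq0.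
rewrite mulrA divfK//.
(* The dependence on [xi] cancels: what remains of each product is the value exp(i pi (P e).om), a
   sign. *)
rewrite (eq_bigr (fun e =>
   (parity (\sum_i bitcV e i 0 * (P^T *m om) i 0))%:~R)); last first.
  move=> e _; rewrite /E -expiN -expiD /xi' dotpDr dotpZr opprK addrA addNr add0r.
  rewrite dotp_intcV mulrC expi_intpi; congr ((parity _)%:~R).
  by under eq_bigr do rewrite mulrC; rewrite sum_mulmx_tr; apply: eq_bigr => i _; rewrite mulrC.
rewrite -rmorph_sum/= sum_bits_parity -(cVbitK om01) even_lattice_tr_bit//.
rewrite /delta (_ : (bitcV _ == 0) = (cVbit om == [ffun=> false])); last first.
  rewrite -(inj_eq (can_inj (@bitcVK d))); congr (_ == _).
  by apply/matrixP => i j; rewrite !mxE ffunE.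
by case: eqP => _; rewrite ?mulr0n ?mulr1n ?mulr0// rmorphXn/= mulVf.
Qed.

(** * Dyadic cubes and affine changes of variables *)

Section boxes.
Context {R : realType}.

(** Half-open, so that the dyadic cubes of one level tile the space without overlap. *)
Definition hbox m (a b : 'I_m -> R) : set 'cV[R]_m :=
  [set x | forall i, a i <= x i 0 < b i].

Lemma measurable_hbox m (a b : 'I_m -> R) : measurable (hbox a b).
Proof.
rewrite (_ : hbox a b =
    \bigcap_i ((@coord_cV R m i) @^-1` [set` `[a i, b i[%R])).
  apply: fin_bigcap_measurable => // i _.
  by rewrite -[X in measurable X]setTI; exact: measurable_coord_cV.
apply/seteqP; split => x /= H i.
  by move=> _; rewrite /= in_itv; exact: H.
by have := H i I; rewrite /= in_itv.
Qed.

Lemma lebesgue_cV_hbox m (a b : 'I_m -> R) : (forall i, a i <= b i) ->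
  lebesgue_cV m (hbox a b) = (\prod_(i < m) (b i - a i))%:E.
Proof.
elim: m => [|m IH] in a b * => ab.
  by rewrite big_ord0 /= diracE mem_set// => -[].
rewrite big_ord_recl /= /lebesgue_cVS /pushforward.
pose a' i := a (lift ord0 i); pose b' i := b (lift ord0 i).
rewrite (_ : _ @^-1` _ = [set` `[a ord0, b ord0[%R] `*` hbox a' b').
  rewrite product_measure1E//; last exact: measurable_hbox.
  rewrite IH; last by move=> i; exact: ab.
  rewrite [X in (X * _)%E](lebesgue_measure_itv `[a ord0, b ord0[%R) /= lte_fin.
  have := ab ord0; rewrite le_eqVlt => /orP[/eqP->|->]; last by rewrite EFinM.
  by rewrite ltxx subrr mul0r mul0e.
apply/seteqP; split => -[t x] /=.
  move=> H; split; first by rewrite in_itv -[t]/((t, x).1) -cons_cV0; exact: H.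
  by move=> i; have := H (lift ord0 i); rewrite cons_cVS.
move=> [H1 H2] i; case: (unliftP ord0 i) => [k ->|->].
  by rewrite cons_cVS; exact: H2.
by rewrite cons_cV0; move: H1; rewrite /= in_itv.
Qed.

(** The cube 2^-j (k + [0,1)^m), scaled up so that membership says that [k] is the vector of floors
    of [2 ^+ j * x]. *)
Definition dcube m (j : nat) (k : 'cV[int]_m) : set 'cV[R]_m :=
  [set x | forall i, (k i ord0)%:~R <= 2 ^+ j * x i ord0 < (k i ord0 + 1)%:~R].

Lemma dcube_hbox m j (k : 'cV[int]_m) : dcube j k =
  hbox (fun i => (k i ord0)%:~R / 2 ^+ j) (fun i => (k i ord0 + 1)%:~R / 2 ^+ j).
Proof.
have p : 0 < 2 ^+ j :> R by rewrite exprn_gt0.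
by apply/seteqP; split => x /= + i => /(_ i);
  rewrite ler_pdivrMr// ltr_pdivlMr// [x i ord0 * _]mulrC.
Qed.

Lemma measurable_dcube m j (k : 'cV[int]_m) : measurable (dcube j k).
Proof. by rewrite dcube_hbox; exact: measurable_hbox. Qed.

Lemma dcube_floor m j (x : 'cV[R]_m) :
  dcube j (\col_i Num.floor (2 ^+ j * x i ord0)) x.
Proof. by move=> i; rewrite mxE floor_le_tmp floorD1_gt. Qed.

(** At a common point the corners satisfy strict inequalities between integers, which therefore
    sharpen to the non-strict ones that inclusion requires. *)
Lemma dcube_nested m j p (k k' : 'cV[int]_m) x :
  dcube j k x -> dcube (j + p) k' x -> dcube (j + p) k' `<=` dcube j k.
Proof.
move=> kx k'x y k'y i.
have a0 : 0 < 2 ^+ p :> R by rewrite exprn_gt0.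
have /andP[k1 k2] := kx i; have /andP[k'1 k'2] := k'x i.
have /andP[y1 y2] := k'y i.
move: k'1 k'2 y1 y2; rewrite exprD [2 ^+ j * _]mulrC -!mulrA => k'1 k'2 y1 y2.
have aE : (2 ^+ p : R) = (2 ^+ p : int)%:~R by rewrite rmorphXn.
have l1 : k i ord0 * 2 ^+ p <= k' i ord0.
  rewrite -ltzD1 -(ltr_int R); apply: le_lt_trans k'2.
  by rewrite intrM -aE mulrC ler_pM2l.
have l2 : k' i ord0 + 1 <= (k i ord0 + 1) * 2 ^+ p.
  rewrite lezD1 -(ltr_int R); apply: le_lt_trans k'1 _.
  by rewrite intrM -aE mulrC ltr_pM2r.
apply/andP; split.
  rewrite -(ler_pM2l a0); apply: le_trans y1.
  by rewrite aE -intrM ler_int mulrC.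
rewrite -(ltr_pM2l a0); apply: lt_le_trans y2 _.
by rewrite aE -intrM ler_int mulrC.
Qed.

(** The empty set is included to make the family stable under intersection. *)
Definition dyadic m : set (set 'cV[R]_m) :=
  [set A | A = set0 \/ exists j k, A = dcube j k].

Lemma measurable_dyadic m : @dyadic m `<=` measurable.
Proof. by move=> _ [->|[j [k ->]]]//; exact: measurable_dcube. Qed.

Lemma dyadic_setI m : setI_closed (@dyadic m).
Proof.
have H j p (k k' : 'cV[int]_m) : dyadic (dcube j k `&` dcube (j + p) k').
  have [->|/set0P[x [xk xk']]] := eqVneq (dcube j k `&` dcube (j + p) k') set0.
    by left.
  right; exists (j + p)%N, k'; apply: setIidr; exact: dcube_nested xk xk'.
move=> A B [->|[j [k ->]]]; first by rewrite set0I; left.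
move=> [->|[j' [k' ->]]]; first by rewrite setI0; left.
case: (leqP j j') => jj'; first by rewrite -(subnKC jj'); exact: H.
by rewrite -(subnKC (ltnW jj')) setIC; exact: H.
Qed.

(** A half-space x_i > r is the countable union of the dyadic cubes whose lower face in direction i
    lies beyond r. *)
Lemma measurable_cV_dyadic m : measurable = <<s @dyadic m >>.
Proof.
apply/seteqP; split; last first.
  apply: smallest_sub; first exact: sigma_algebra_measurable.
  exact: measurable_dyadic.
apply: smallest_sub; first exact: smallest_sigma_algebra.
case: m => [|m]; first by rewrite big_ord0.
rewrite -bigcup_mkord_ord; apply: bigcup_sub => i _.
move=> A [B mB <-]; move: (inord i) B mB => {}i B mB.
have := @measurability _ _ (g_sigma_algebraType (@dyadic m.+1)) _ setT
  (@coord_cV R m.+1 i) _ (measurable_realfun.RGenOInfty.measurableE R).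
apply => // _ [_ [r ->] <-]; rewrite setTI.
rewrite (_ : _ @^-1` _ =
    \bigcup_(p : nat * 'cV[int]_m.+1)
      (if r < (p.2 i ord0)%:~R / 2 ^+ p.1 then dcube p.1 p.2 else set0)).
  apply: countable_bigcupT_measurable; first exact: countableP.
  move=> [j k]/=; case: ifP => _; last exact: measurable0.
  by apply: sub_sigma_algebra; right; exists j, k.
apply/seteqP; split => [x /=|x [[j k] _ /=]].
  rewrite /coord_cV in_itv/= andbT => rx.
  have xr : 0 < x i 0 - r by rewrite subr_gt0.
  (* A cube of side below the distance from [x] to the boundary cannot reach back to r. *)
  have [j hj] : exists j, 2 ^- j < x i 0 - r.
    have := near_infty_natSinv_expn_lt (PosNum xr) => -[N _ HN].
    by exists N; have := HN N (leqnn _); rewrite div1r.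
  exists (j, \col_l Num.floor (2 ^+ j * x l 0)) => //=.
  rewrite ifT; first exact: dcube_floor.
  have p : 0 < 2 ^+ j :> R by rewrite exprn_gt0.
  rewrite mxE ltr_pdivlMr//.
  have := floorD1_gt (2 ^+ j * x i 0); rewrite intrD -ltrBlDr; apply: le_lt_trans.
  have : 1 <= (x i 0 - r) * 2 ^+ j by rewrite -ler_pdivrMr// div1r ltW.
  rewrite mulrBl mulrC; lra.
case: ifP => // rk xk; rewrite /coord_cV in_itv/= andbT.
apply: lt_le_trans rk _; rewrite ler_pdivrMr ?exprn_gt0// mulrC.
by have /andP[] := xk i.
Qed.

Lemma eq_measure_dcube m (m1 m2 : {measure set 'cV[R]_m -> \bar R}) :
  (forall j k, m1 (dcube j k) = m2 (dcube j k)) ->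
  (forall k, (m1 (dcube 0 k) < +oo)%E) ->
  forall A, measurable A -> m1 A = m2 A.
Proof.
move=> m12 m1oo A; rewrite measurable_cV_dyadic.
(* Numbers that code no vector repeat the cube at 0, which is harmless for a covering. *)
pose g n := dcube 0 (odflt (0 : 'cV[int]_m) (unpickle n)).
apply: (@g_sigma_algebra_measure_unique _ _ _ (@dyadic m) _ g).
- exact: measurable_dyadic.
- by move=> n; right; exists 0%N, (odflt 0 (unpickle n)).
- apply/seteqP; split => // x _.
  exists (pickle (\col_i Num.floor (2 ^+ 0 * x i ord0))) => //.
  by rewrite /g pickleK; exact: dcube_floor.
- exact: dyadic_setI.
- by move=> _ [->|[j [k ->]]]; [rewrite !measure0|exact: m12].
- by move=> n; exact: m1oo.
Qed.

End boxes.

Section affine_change_of_variables.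
Context {R : realType}.
Variable m : nat.
Local Notation mu := (@lebesgue_cV R m).

Definition pushforward_measure d d' (T : measurableType d) (T' : measurableType d')
    (nu : {measure set T -> \bar R}) (f : T -> T') (mf : measurable_fun setT f) :
    {measure set T' -> \bar R} :=
  measure_function_pushforward__canonical__measure_function_Measure nu mf.

Definition affine_cV (s : R) (c x : 'cV[R]_m) : 'cV[R]_m := s *: x + c.

Lemma measurable_affine_cV s c : measurable_fun setT (affine_cV s c).
Proof.
apply: measurable_fun_cVP => i.
rewrite (_ : _ \o _ = fun x => s * coord_cV i x + c i 0); last first.
  by apply/funext => x; rewrite /coord_cV/= !mxE.
apply: measurable_funD => //; apply: measurable_funM => //.
exact: measurable_coord_cV.
Qed.

Variables (s : R) (s0 : 0 < s) (c : 'cV[R]_m).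

Lemma preimage_affine_hbox (a b : 'I_m -> R) : affine_cV s c @^-1` hbox a b =
  hbox (fun i => (a i - c i ord0) / s) (fun i => (b i - c i ord0) / s).
Proof.
by apply/seteqP; split => x /= + i => /(_ i); rewrite !mxE;
  rewrite ler_pdivrMr// ltr_pdivlMr// lerBlDr ltrBrDr [s * _]mulrC.
Qed.

Let sm0 : 0 <= s ^+ m. Proof. by rewrite exprn_ge0// ltW. Qed.

(** The preimage of a box has its volume divided by s^m; the factor restores it, so this measure
    agrees with [mu] on the dyadic cubes. *)
Let image_measure : {measure set 'cV[R]_m -> \bar R} :=
  mscale (NngNum sm0) (pushforward_measure mu (measurable_affine_cV s c)).

Let image_measureE A : measurable A -> image_measure A = mu A.
Proof.
have H j (k : 'cV[int]_m) : image_measure (dcube j k) = mu (dcube j k).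
  rewrite [LHS](_ : _ = (s ^+ m)%:E * mu (affine_cV s c @^-1` dcube j k))%E//.
  rewrite dcube_hbox.
  rewrite preimage_affine_hbox.
  have le1 i : (k i ord0)%:~R / 2 ^+ j <= (k i ord0 + 1)%:~R / 2 ^+ j :> R.
    by rewrite ler_pM2r ?invr_gt0 ?exprn_gt0// ler_int lerDl.
  rewrite !lebesgue_cV_hbox//; last first.
    by move=> i; rewrite ler_pM2r ?invr_gt0// lerD2r.
  rewrite -EFinM -[X in s ^+ X]card_ord -prodr_const -big_split/=.
  congr EFin; apply: eq_bigr => i _.
  by field; rewrite gt_eqF ?exprn_gt0//= gt_eqF.
apply: eq_measure_dcube => // k.
by rewrite H dcube_hbox lebesgue_cV_hbox ?ltry// => i;
  rewrite ler_pM2r ?invr_gt0 ?exprn_gt0// ler_int lerDl.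
Qed.

Lemma lebesgue_cV_affine A : measurable A ->
  ((s ^+ m)%:E * mu (affine_cV s c @^-1` A) = mu A)%E.
Proof. exact: image_measureE. Qed.

Lemma ge0_integral_affine (f : 'cV[R]_m -> \bar R) :
  measurable_fun setT f -> (forall x, 0 <= f x)%E ->
  ((s ^+ m)%:E * \int[mu]_x f (affine_cV s c x) = \int[mu]_x f x)%E.
Proof.
move=> mf f0.
rewrite [RHS](@eq_measure_integral _ _ _ _ image_measure); last first.
  by move=> A mA _; exact/esym/image_measureE.
rewrite ge0_integral_mscale//.
by rewrite (ge0_integral_pushforward (measurable_affine_cV s c)).
Qed.

Lemma ge0_integral_affineV (f : 'cV[R]_m -> \bar R) :
  measurable_fun setT f -> (forall x, 0 <= f x)%E ->
  (\int[mu]_x f (affine_cV s c x) = (s ^- m)%:E * \int[mu]_x f x)%E.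
Proof.
move=> mf f0; rewrite -[in RHS]ge0_integral_affine//.
by rewrite muleA -EFinM mulVf ?mul1e// gt_eqF ?exprn_gt0.
Qed.

Lemma integrable_affine (f : 'cV[R]_m -> \bar R) :
  mu.-integrable setT f -> mu.-integrable setT (f \o affine_cV s c).
Proof.
move=> /integrableP[mf foo]; apply/integrableP; split.
  by apply: measurableT_comp => //; exact: measurable_affine_cV.
have sm : 0 < s ^+ m by rewrite exprn_gt0.
rewrite (@ge0_integral_affineV (fun x => `|f x|%E))//; last first.
  exact: measurableT_comp.
by rewrite lte_mul_pinfty// lee_fin invr_ge0 ltW.
Qed.

Lemma Rintegral_affine (f : 'cV[R]_m -> R) :
  mu.-integrable setT (EFin \o f) ->
  Rintegral mu setT (f \o affine_cV s c) = s ^- m * Rintegral mu setT f.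
Proof.
move=> fi; have mf := measurable_int _ fi.
rewrite /Rintegral.
have gi := integrable_affine fi.
rewrite integralE [in RHS]integralE.
have -> : (\int[mu]_x ((fun x => (f (affine_cV s c x))%:E)^\+ x) =
   (s ^- m)%:E * \int[mu]_x ((EFin \o f)^\+ x))%E.
  rewrite -ge0_integral_affineV//; last exact: measurable_funepos.
  by apply: eq_integral => x _; rewrite !funeposE.
have -> : (\int[mu]_x ((fun x => (f (affine_cV s c x))%:E)^\- x) =
   (s ^- m)%:E * \int[mu]_x ((EFin \o f)^\- x))%E.
  rewrite -ge0_integral_affineV//; last exact: measurable_funeneg.
  by apply: eq_integral => x _; rewrite !funenegE.
have pf := integrable_pos_fin_num measurableT fi.
have nf := integrable_neg_fin_num measurableT fi.
rewrite fineB ?fin_numM// [in RHS]fineB//.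
by rewrite [fine (_ * _)%E]fineM// [X in _ - X]fineM// mulrBr.
Qed.

Lemma ae_affine (Q : 'cV[R]_m -> Prop) :
  {ae mu, forall x, Q x} -> {ae mu, forall x, Q (affine_cV s c x)}.
Proof.
move=> [N [mN N0 QN]]; exists (affine_cV s c @^-1` N); split.
- by rewrite -[X in measurable X]setTI; exact: measurable_affine_cV.
- apply/eqP; have /eqP := lebesgue_cV_affine mN.
  by rewrite N0 mule_eq0 => /orP[|//]; rewrite eqe expf_eq0 gt_eqF// andbF.
- by move=> x /= /QN.
Qed.

End affine_change_of_variables.

(** * Unordered countable sums *)

Section countable_sums.
Local Open Scope ereal_scope.
Context {R : realType}.

(** Turns an unordered sum into a series, where countable additivity and monotone convergence apply;
    numbers that code nothing contribute 0. *)
Lemma esum_pickle (T : countType) (a : T -> \bar R) : (forall k, 0 <= a k) ->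
  \esum_(k in [set: T]) a k = \sum_(i <oo) oapp a 0 (@pickle_inv T i).
Proof.
move=> a0; rewrite nneseries_esumT; last by move=> i; case: pickle_inv.
rewrite [RHS](_ : _ = \esum_(i in range (@pickle T)) oapp a 0 (pickle_inv i)).
  rewrite (@reindex_esum R T nat setT _ (@pickle T)).
    by apply: eq_esum => k _; rewrite pickleK_inv.
  split; [by move=> x _; exists x| |by move=> x [y _ <-]; exists y].
  by move=> x y _ _; exact: (pcan_inj (@pickleK T)).
rewrite [RHS]esum_mkcond; apply: eq_esum => i _.
case: ifPn => // /negP; rewrite inE/=.
case Ei : (pickle_inv i) => [x|]//=; case; exists x => //.
by have := @pickle_invK T i; rewrite Ei.
Qed.

Lemma esum_fintype (T : finType) (a : T -> \bar R) : (forall k, 0 <= a k) ->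
  \esum_(k in [set: T]) a k = \sum_k a k.
Proof.
move=> a0; rewrite esum_fset//; last exact: finite_finset.
rewrite (fsbigE (index_enum T))//.
- by apply: eq_bigl => k; rewrite in_setT.
- exact: index_enum_uniq.
- by move=> i _; rewrite mem_index_enum.
Qed.

Lemma measure_countable_bigcup d (X : measurableType d)
    (nu : {measure set X -> \bar R}) (T : countType) (F : T -> set X) :
  (forall k, measurable (F k)) -> trivIset setT F ->
  nu (\bigcup_k F k) = \esum_(k in [set: T]) nu (F k).
Proof.
move=> mF tF; rewrite esum_pickle//.
pose G i := oapp F set0 (@pickle_inv T i).
rewrite (_ : \bigcup_k F k = \bigcup_i G i).
  rewrite measure_semi_bigcup//.
  - by apply: eq_eseriesr => i _; rewrite /G; case: pickle_inv => //=.
  - by move=> i; rewrite /G; case: pickle_inv => //=.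
  - move=> i j _ _; rewrite /G.
    have := @pickle_invK T i; have := @pickle_invK T j.
    case: (pickle_inv j) => [y /= <-|_ _ [x []]//].
    case: (pickle_inv i) => [x /= <-|_ [x []]//] xy.
    by congr pickle; apply: tF.
  - by apply: bigcup_measurable => i _; rewrite /G; case: pickle_inv => //=.
apply/seteqP; split => [x [k _ Fkx]|x [i _]].
  by exists (pickle k) => //; rewrite /G pickleK_inv.
by rewrite /G; case: pickle_inv => [k Fk|]//; exists k.
Qed.

(** One inequality is proved for every factor; applied to c^-1 it yields the reverse one. The factor
    0 is separate because the sum may be infinite. *)
Lemma esumZl (T : choiceType) (a : T -> \bar R) (c : R) : (0 <= c)%R ->
  (forall k, 0 <= a k) ->
  \esum_(k in [set: T]) (c%:E * a k) = c%:E * \esum_(k in [set: T]) a k.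
Proof.
move=> c0 a0.
have le b (r : R) : (0 <= r)%R -> (forall k, 0 <= b k) ->
    \esum_(k in [set: T]) (r%:E * b k) <= r%:E * \esum_(k in [set: T]) b k.
  move=> r0 b0; apply: ge_ereal_sup => _ [X [finX _] <-].
  rewrite -ge0_mule_fsumr//; apply: lee_wpmul2l; first by rewrite lee_fin.
  by apply: ereal_sup_ubound; exists X.
move: c0; rewrite le_eqVlt => /predU1P[<-|c0].
  by rewrite mul0e esum1// => k _; rewrite mul0e.
apply/eqP; rewrite eq_le le ?(ltW c0)//=.
rewrite -lee_pdivlMl//.
apply: le_trans (le _ _ _ _); rewrite ?invr_ge0 ?(ltW c0)//.
  by apply: le_esum => k _; rewrite muleA -EFinM mulVf ?gt_eqF// mul1e.
by move=> k; rewrite mule_ge0// lee_fin ltW.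
Qed.

Lemma ge0_integral_esum d (X : measurableType d) (nu : {measure set X -> \bar R})
    (T : countType) (f : T -> X -> \bar R) :
  (forall k, measurable_fun setT (f k)) -> (forall k x, 0 <= f k x) ->
  \int[nu]_x (\esum_(k in [set: T]) f k x) =
  \esum_(k in [set: T]) \int[nu]_x f k x.
Proof.
move=> mf f0.
rewrite (_ : (fun x => _) =
    fun x => \sum_(i <oo) (oapp f (cst 0) (@pickle_inv T i)) x); last first.
  apply/funext => x; rewrite esum_pickle//; apply: eq_eseriesr => i _.
  by case: pickle_inv.
rewrite integral_nneseries//; last 2 first.
- by move=> i; case: pickle_inv => //=.
- by move=> i x _; case: pickle_inv => //=.
rewrite esum_pickle; last by move=> k; apply: integral_ge0.
by apply: eq_eseriesr => i _; case: pickle_inv => //=; rewrite integral0.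
Qed.

Lemma measurable_esum d (X : measurableType d) (T : countType)
    (f : T -> X -> \bar R) :
  (forall k, measurable_fun setT (f k)) -> (forall k x, 0 <= f k x) ->
  measurable_fun setT (fun x => \esum_(k in [set: T]) f k x).
Proof.
move=> mf f0.
rewrite (_ : (fun x => _) =
    fun x => \sum_(i <oo) (oapp f (cst 0) (@pickle_inv T i)) x); last first.
  apply/funext => x; rewrite esum_pickle//; apply: eq_eseriesr => i _.
  by case: pickle_inv.
apply: ge0_emeasurable_sum => [i x _ _|i _]; case: pickle_inv => //=.
Qed.

(** Each p is 2k + P e for exactly 2^(n-d) bit vectors e, and then e determines k. The lemma serves
    both the mass of the translates and the energies. *)
Lemma esum_bits (d n : nat) (P : 'M[int]_(d, n)) (g : 'cV[int]_d -> \bar R) :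
  [set P^T *m k | k in ~` even_lattice d] `<=` ~` even_lattice n ->
  (d <= n)%N -> (forall k, 0 <= g k) ->
  \esum_(k in [set: 'cV[int]_d]) \sum_(e : {ffun 'I_n -> bool})
     g ((2 : int) *: k + P *m bitcV e)%R =
  (2 ^+ (n - d))%:E * \esum_(p in [set: 'cV[int]_d]) g p.
Proof.
move=> P2 dn g0; rewrite esum_sum//.
pose ev (e : {ffun 'I_n -> bool}) p := `[< even_lattice d (p - P *m bitcV e)%R >].
(* For fixed [e], the map k to 2k + P e is a bijection onto the class of P e modulo 2. *)
transitivity (\sum_(e : {ffun 'I_n -> bool}) \esum_(p in [set: 'cV[int]_d])
    (if p \in [set p | ev e p] then g p else 0)).
  apply: eq_bigr => e _; rewrite -esum_mkcond.
  rewrite [RHS](@reindex_esum _ _ _ setT _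
    (fun k => (2 : int) *: k + P *m bitcV e)%R)//.
  split.
  - by move=> k _; apply/asboolP; rewrite addrK; exists k.
  - move=> k k' _ _ /addIr/matrixP kk'; apply/matrixP => i j.
    by have := kk' i j; rewrite !mxE; apply: mulfI.
  - move=> p /asboolP[k _ kp]; exists k => //.
    by rewrite kp subrK.
rewrite -esum_sum; last by move=> p e _ _; case: ifP.
rewrite -esumZl ?exprn_ge0//; apply: eq_esum => p _.
rewrite -big_mkcond/= (eq_bigl (fun e => ev e p)); last first.
  by move=> e; apply/idP/idP; rewrite inE.
rewrite (eq_bigr (fun=> 1 * g p)); last by move=> e _; rewrite mul1e.
rewrite -ge0_sume_distrl//; congr (_ * _).
have := card_bits_mod2 P2 p dn => /(congr1 (fun k => (k%:R : R)%:E)).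
by rewrite natr_sum natrX -sumEFin.
Qed.

End countable_sums.

(** * The box spline *)

Section integer_translates.
Context {R : realType}.

Lemma trivIset_dcube m j : trivIset setT (@dcube R m j).
Proof.
move=> k k' _ _ [x [kx k'x]]; apply/matrixP => i l; rewrite (ord1 l).
have /andP[k1 k2] := kx i; have /andP[k'1 k'2] := k'x i.
have := le_lt_trans k1 k'2; rewrite ltr_int ltzD1 => h1.
have := le_lt_trans k'1 k2; rewrite ltr_int ltzD1 => h2.
by apply/eqP; rewrite eq_le h1 h2.
Qed.

Lemma bigcup_dcube m j : \bigcup_k @dcube R m j k = setT.
Proof.
apply/seteqP; split => // x _; exists (\col_i Num.floor (2 ^+ j * x i ord0)) => //.
exact: dcube_floor.
Qed.

Lemma intcVD m (k k' : 'cV[int]_m) : intcV (k + k') = intcV k + intcV k' :> 'cV[R]_m.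
Proof. by apply/matrixP => i j; rewrite !mxE rmorphD. Qed.

Lemma intcVZ m (a : int) (k : 'cV[int]_m) :
  intcV (a *: k) = a%:~R *: intcV k :> 'cV[R]_m.
Proof. by apply/matrixP => i j; rewrite !mxE rmorphM. Qed.

Lemma intcV0 m : intcV (0 : 'cV[int]_m) = 0 :> 'cV[R]_m.
Proof. by apply/matrixP => i j; rewrite !mxE. Qed.

Lemma preimage_translate_dcube m (k k' : 'cV[int]_m) :
  affine_cV 1 (intcV k) @^-1` @dcube R m 0 k' = dcube 0 (k' - k).
Proof.
by apply/seteqP; split => x /= + i => /(_ i);
  rewrite !mxE !expr0 !mul1r [(_ - _ + 1)%R]addrAC !intrD mulrNz
    lerBlDr ltrBrDr.
Qed.

Lemma preimage_half_dcube m j (k : 'cV[int]_m) :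
  affine_cV 2^-1 0 @^-1` @dcube R m j.+1 k = dcube j k.
Proof.
by apply/seteqP; split => x /= + i => /(_ i);
  rewrite !mxE addr0 mulrA exprSr mulfK ?pnatr_eq0.
Qed.

Lemma lebesgue_cV_dcube m j (k : 'cV[int]_m) :
  lebesgue_cV m (@dcube R m j k) = ((2 ^- j) ^+ m)%:E.
Proof.
rewrite dcube_hbox lebesgue_cV_hbox; last first.
  by move=> i; rewrite ler_pM2r ?invr_gt0 ?exprn_gt0// ler_int lerDl.
congr EFin; rewrite (eq_bigr (fun=> 2 ^- j)) ?prodr_const ?card_ord// => i _.
by rewrite -mulrBl -intrB addrAC subrr add0r mul1r.
Qed.

End integer_translates.

Section box_measure.
Local Open Scope ereal_scope.
Context {R : realType}.
Variables (d n : nat) (P : 'M[int]_(d, n)).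

Definition mulmx_intr (t : 'cV[R]_n) : 'cV[R]_d := (map_mx intr P *m t)%R.

Lemma measurable_mulmx_intr : measurable_fun setT mulmx_intr.
Proof.
apply: measurable_fun_cVP => i.
rewrite (_ : _ \o _ = fun t => (\sum_j (P i j)%:~R * coord_cV j t)%R).
  apply: measurable_sum => j; apply: measurable_funM => //.
  exact: measurable_coord_cV.
apply/funext => t; rewrite /coord_cV/= mxE.
by apply: eq_bigr => j _; rewrite mxE.
Qed.

(* The measure with density M_P: the image under P of Lebesgue measure on the
   unit cube. *)
Definition box_measure (A : set 'cV[R]_d) : \bar R :=
  lebesgue_cV n (mulmx_intr @^-1` A `&` dcube 0 0).

Let box_measure_pushforward : {measure set 'cV[R]_d -> \bar R} :=
  pushforward_measure (mrestr (lebesgue_cV n) (measurable_dcube 0 0))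
    measurable_mulmx_intr.

Let box_measure0 : box_measure set0 = 0.
Proof. exact: (measure0 box_measure_pushforward). Qed.

Let box_measure_ge0 A : 0 <= box_measure A.
Proof. exact: measure_ge0. Qed.

Let box_measure_sigma_additive : semi_sigma_additive box_measure.
Proof. exact: (@measure_semi_sigma_additive _ _ _ box_measure_pushforward). Qed.

HB.instance Definition _ := isMeasure.Build _ _ _ box_measure
  box_measure0 box_measure_ge0 box_measure_sigma_additive.

Lemma box_measure_setT : box_measure setT = 1.
Proof.
by rewrite /box_measure preimage_setT setTI lebesgue_cV_dcube expr0 invr1 expr1n.
Qed.

Let box_measure_fin : fin_num_fun box_measure.
Proof.
move=> A mA; rewrite ge0_fin_numE//; apply: (@le_lt_trans _ _ (box_measure setT)).
  by apply: le_measure; rewrite ?inE.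
by rewrite box_measure_setT ltry.
Qed.

HB.instance Definition _ := Measure_isFinite.Build _ _ _ box_measure
  box_measure_fin.

Lemma preimage_mulmx_intr_affine (A : set 'cV[R]_d) (s : R) (k : 'cV[int]_n)
    (t : 'cV[R]_n) :
  mulmx_intr (affine_cV s (s *: intcV k) t) =
  affine_cV s (s *: intcV (P *m k))%R (mulmx_intr t).
Proof. by rewrite /mulmx_intr /affine_cV mulmxDr -!scalemxAr /intcV map_mxM. Qed.

(** The doubled cube [0,2)^n is the union of the unit cubes with corner in {0,1}^n; a bit records
    whether the coordinate reaches 1. *)
Lemma half_dcube (t : 'cV[R]_n) : dcube 0 0 (affine_cV 2^-1 0 t) <->
  exists e : {ffun 'I_n -> bool}, dcube 0 (bitcV e) t.
Proof.
split=> [t01|[e te] i]; last first.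
  have := te i; rewrite !mxE !expr0 !mul1r addr0 add0r intrD mulr0z mulr1z.
  case: (e i) => /=; rewrite ?mulr0n ?mulr1n ?mulr0z ?mulr1z => /andP[]; lra.
exists [ffun i => (1 <= t i ord0)%R] => i.
have := t01 i; rewrite !mxE ffunE !expr0 !mul1r addr0 add0r intrD mulr0z mulr1z.
case: (lerP 1 (t i ord0)) => /= ti /andP[];
  rewrite ?mulr0n ?mulr1n ?mulr0z ?mulr1z; lra.
Qed.

(** Substituting t/2 for t costs the Jacobian 2^-n and spreads the unit cube over 2^n unit cubes;
    each is translated back to the origin, which under P becomes a translation by P e. *)
Lemma box_measure_refine A : measurable A ->
  box_measure A = (2 ^- n)%:E * \sum_(e : {ffun 'I_n -> bool})
    box_measure (affine_cV 2^-1 (2^-1 *: intcV (P *m bitcV e))%R @^-1` A).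
Proof.
move=> mA.
have mX : measurable (mulmx_intr @^-1` A `&` dcube 0 0).
  apply: measurableI; last exact: measurable_dcube.
  by rewrite -[X in measurable X]setTI; exact: measurable_mulmx_intr.
have half0 : (0 < 2^-1 :> R)%R by rewrite invr_gt0.
rewrite /box_measure -(lebesgue_cV_affine half0 0 mX) exprVn; congr (_ * _).
pose F e := affine_cV 2^-1 0 @^-1` (mulmx_intr @^-1` A) `&` dcube 0 (bitcV e).
rewrite (_ : _ @^-1` _ = \bigcup_e F e).
  rewrite measure_countable_bigcup.
  - rewrite esum_fintype//; apply: eq_bigr => e _.
    rewrite -[LHS](@lebesgue_cV_affine _ _ 1 _ (intcV (bitcV e)) (F e))//.
      rewrite expr1n mul1e; congr (lebesgue_cV n _).
      rewrite /F preimage_setI preimage_translate_dcube subrr; congr (_ `&` _).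
      apply/funext => t /=; rewrite -preimage_mulmx_intr_affine//.
      by rewrite /affine_cV addr0 scale1r scalerDr.
    apply: measurableI; last exact: measurable_dcube.
    rewrite -comp_preimage -[X in measurable X]setTI.
    apply: (measurableT_comp measurable_mulmx_intr) => //.
    exact: measurable_affine_cV.
  - move=> e; apply: measurableI; last exact: measurable_dcube.
    rewrite -comp_preimage -[X in measurable X]setTI.
    apply: (measurableT_comp measurable_mulmx_intr) => //.
    exact: measurable_affine_cV.
  - move=> e e' _ _ [x [[_ xe] [_ xe']]]; apply: (can_inj (@bitcVK n)).
    by apply: (@trivIset_dcube R n 0) => //; exists x.
apply/seteqP; split => t /=.
  by move=> [At /half_dcube[e te]]; exists e.
by move=> [e _ [At te]]; split => //; apply/half_dcube; exists e.
Qed.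

Hypothesis P2 : [set P^T *m k | k in ~` even_lattice d] `<=` ~` even_lattice n.
Hypothesis dn : (d <= n)%N.

(** A sequence, as [mseries] requires; numbers that code no vector carry the zero measure. *)
Let translates (i : nat) : {measure set 'cV[R]_d -> \bar R} :=
  oapp (fun k => pushforward_measure box_measure (measurable_affine_cV 1 (intcV k)))
    mzero (@pickle_inv 'cV[int]_d i).

Let U : {measure set 'cV[R]_d -> \bar R} := mseries translates 0.

Let UE A : U A = \esum_(k in [set: 'cV[int]_d])
  box_measure (affine_cV 1 (intcV k) @^-1` A).
Proof.
rewrite esum_pickle// /U /mseries; apply: eq_eseriesr => i _.
by rewrite /translates; case: pickle_inv.
Qed.

(** Refining the translate at k yields halved translates at 2k + P e. Each integer vector arises
    2^(n-d) times, which turns 2^-n into 2^-d. *)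
Let U_half A : measurable A -> U A = (2 ^- d)%:E * U (affine_cV 2^-1 0 @^-1` A).
Proof.
move=> mA; rewrite !UE.
pose g p := box_measure (affine_cV 2^-1 (2^-1 *: intcV p)%R @^-1` A).
transitivity (\esum_(k in [set: 'cV[int]_d]) ((2 ^- n)%:E *
    \sum_(e : {ffun 'I_n -> bool}) g ((2 : int) *: k + P *m bitcV e)%R)).
  apply: eq_esum => k _; rewrite box_measure_refine; last first.
    by rewrite -[X in measurable X]setTI; exact: measurable_affine_cV.
  congr (_ * _); apply: eq_bigr => e _; congr box_measure.
  apply/funext => x /=; congr (A _); rewrite /affine_cV scale1r intcVD intcVZ.
  by rewrite scalerDr scalerA mulVf ?scale1r ?pnatr_eq0// addrA addrAC.
rewrite esumZl ?invr_ge0 ?exprn_ge0//; last first.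
  by move=> k; apply: sume_ge0 => e _.
rewrite esum_bits// muleA; congr (_ * _).
  rewrite -EFinM -{1}(subnK dn) exprD invfM mulrAC mulVf ?mul1r//.
apply: eq_esum => k _; congr box_measure; apply/funext => x /=; congr (A _).
by rewrite /affine_cV scale1r addr0 scalerDr.
Qed.

(** The translates of one unit cube are all the unit cubes, so their masses add up to the total mass
    of the box measure. *)
Let U_unit_cube k : U (dcube 0 k) = 1.
Proof.
rewrite UE.
under eq_esum do rewrite preimage_translate_dcube.
rewrite -(@reindex_esum _ _ _ setT setT (fun p => k - p)%R
  (fun p => box_measure (dcube 0 p))); last first.
  split => //; first by move=> x y _ _ /addrI/oppr_inj.
  by move=> x _; exists (k - x)%R => //; rewrite opprB addrC subrK.
transitivity (box_measure (\bigcup_(k : 'cV[int]_d) dcube 0 k)).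
  apply/esym/measure_countable_bigcup; last exact: trivIset_dcube.
  by move=> ?; exact: measurable_dcube.
by rewrite bigcup_dcube box_measure_setT.
Qed.

Let U_dcube j k : U (dcube j k) = ((2 ^- j) ^+ d)%:E.
Proof.
elim: j => [|j IH]; first by rewrite U_unit_cube expr0 invr1 expr1n.
rewrite U_half; last exact: measurable_dcube.
by rewrite preimage_half_dcube IH -EFinM -exprVn -exprMn -invfM -exprS.
Qed.

(* The sum U of the integer translates of the box measure is Z^d-periodic, has
   mass 1 on the unit cube and satisfies U(A) = 2^-d U(2A); hence it agrees with
   Lebesgue measure on every dyadic cube. *)
Lemma esum_translate_box_measure A : measurable A ->
  \esum_(k in [set: 'cV[int]_d]) box_measure (affine_cV 1 (intcV k) @^-1` A) =
  lebesgue_cV d A.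
Proof.
rewrite -UE => mA; apply: eq_measure_dcube => // [j k|k].
  exact: etrans (U_dcube j k) (esym (lebesgue_cV_dcube j k)).
by rewrite U_unit_cube ltry.
Qed.

(** The box measure is the term at 0 of a sum of non-negative terms that equals Lebesgue measure. *)
Lemma box_measure_le A : measurable A -> box_measure A <= lebesgue_cV d A.
Proof.
move=> mA; rewrite -esum_translate_box_measure//; apply: esum_ge.
exists [set 0%R]; first by split.
rewrite fsbig_set1 le_eqVlt; apply/orP; left; apply/eqP; congr box_measure.
by apply/funext => x /=; rewrite /affine_cV intcV0 scale1r addr0.
Qed.

End box_measure.

Lemma ae_forall_countable d (X : measurableType d) (R : realType)
    (nu : {measure set X -> \bar R}) (T : countType) (Q : T -> X -> Prop) :
  (forall k, {ae nu, forall x, Q k x}) -> {ae nu, forall x, forall k, Q k x}.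
Proof.
move=> aeQ.
have : {ae nu, forall x, forall i,
    oapp (fun k => Q k x) True (@pickle_inv T i)}.
  by apply: ae_foralln => i; case: pickle_inv => [k|]; [exact: aeQ|exact: aeW].
by apply: filterS => x Qx k; have := Qx (pickle k); rewrite pickleK_inv.
Qed.

Section box_spline.
Context {R : realType}.
Variables (d n : nat) (P : 'M[int]_(d, n)).
Hypothesis P2 : [set P^T *m k | k in ~` even_lattice d] `<=` ~` even_lattice n.
Hypothesis dn : (d <= n)%N.
Local Notation mu := (@lebesgue_cV R d).
Local Notation nu := (@box_measure R d n P).

Let dominated : nu `<< mu.
Proof.
apply/null_content_dominatesP => A mA mA0; apply/eqP; rewrite eq_le measure_ge0 andbT.
by rewrite -mA0; exact: box_measure_le.
Qed.

Let f := Radon_Nikodym_SigmaFinite.f nu mu.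

Let f_ge0 x : (0 <= f x)%E.
Proof. exact: Radon_Nikodym_SigmaFinite.f_ge0. Qed.

Let f_fin x : f x \is a fin_num.
Proof. exact: Radon_Nikodym_SigmaFinite.f_fin_num. Qed.

Let mf : measurable_fun setT f.
Proof. exact: measurable_int (Radon_Nikodym_SigmaFinite.f_integrable _). Qed.

Let f_integral A : measurable A -> nu A = (\int[mu]_(x in A) f x)%E.
Proof. exact: Radon_Nikodym_SigmaFinite.f_integral. Qed.

(** Bounds coordinate i of P t for t in the unit cube. *)
Definition box_radius (i : 'I_d) : R := \sum_j `|P i j|%:~R.

Definition box_support : set 'cV[R]_d :=
  box_cV (fun i => - box_radius i) box_radius.

Let measurable_support : measurable box_support.
Proof. exact: measurable_box_cV. Qed.

Let box_measure_support : nu (~` box_support) = 0%E.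
Proof.
rewrite /box_measure (_ : _ `&` _ = set0) ?measure0//.
apply/seteqP; split => // t [/= tS t01]; apply: tS => i.
rewrite in_itv/= -ler_norml mxE; apply: le_trans (ler_norm_sum _ _ _) _.
apply: ler_sum => j _; rewrite mxE normrM intr_norm -[leRHS]mulr1.
apply: ler_wpM2l => //.
have := t01 j; rewrite !mxE expr0 mul1r add0r => /andP[t0 t1].
by rewrite ger0_norm// ltW.
Qed.

Let f_support : ae_eq mu (~` box_support) f (cst 0%E).
Proof.
apply/ae_eq_integral_abs.
- exact: measurableC.
- exact: measurable_funTS.
under eq_integral do rewrite gee0_abs//.
by rewrite -f_integral//; exact: measurableC.
Qed.

(** On the set N where f > 1, the integral of f - 1 plus mu N equals nu N, which is at most mu N.
    Hence that integral of a positive function is 0 and N is null. *)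
Let f_le1 : {ae mu, forall x, (f x <= 1)%E}.
Proof.
pose N := [set x | (1 < f x)%E].
have mN : measurable N.
  by rewrite -[N]setTI; apply: emeasurable_fun_o_infty.
have split_f : (\int[mu]_(x in N) f x = \int[mu]_(x in N) (f x - 1) + mu N)%E.
  rewrite -[mu N]mul1e -integral_cst// -ge0_integralD//.
  - by apply: eq_integral => x _; rewrite subeK.
  - by move=> x /ltW; rewrite sube_ge0.
  - by apply: emeasurable_funB => //; exact: measurable_funTS.
have int0 : (0 <= \int[mu]_(x in N) (f x - 1))%E.
  by apply: integral_ge0 => x /ltW; rewrite sube_ge0.
(* Finiteness allows mu N to be subtracted from both sides. *)
have Noo : mu N \is a fin_num.
  rewrite ge0_fin_numE//; apply: (@le_lt_trans _ _ (nu N)); last first.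
    by rewrite ltey_eq fin_num_measure.
  by rewrite f_integral// split_f leeDr.
have : (\int[mu]_(x in N) (f x - 1) + mu N <= mu N)%E.
  by rewrite -split_f -f_integral//; exact: box_measure_le.
rewrite -leeBrDr// subee// => int_le0.
have /ae_eq_integral_abs : (\int[mu]_(x in N) `|f x - 1| = 0)%E.
  rewrite (eq_integral (fun x => f x - 1)%E); last first.
    by move=> x; rewrite inE => /ltW ?; rewrite gee0_abs// sube_ge0.
  by apply/eqP; rewrite eq_le int_le0 int0.
have mN1 : measurable_fun N (fun x => f x - 1)%E.
  by apply: emeasurable_funB => //; exact: measurable_funTS.
move=> /(_ mN mN1); apply: filterS => x Nx; rewrite leNgt; apply/negP => fx.
have := Nx fx; have := f_fin x; move: fx; case: (f x) => [r| |]//=.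
by rewrite lte_fin => r1 _ [] /eqP; rewrite subr_eq0 gt_eqF.
Qed.

(** The density is changed on a null set so that the bounds 0 and 1 and the support hold at every
    point. *)
Definition box_spline (x : 'cV[R]_d) : R :=
  Num.min (fine (f x)) 1 * \1_box_support x.

Local Notation M := box_spline.

Lemma measurable_box_spline : measurable_fun setT M.
Proof.
apply: measurable_funM => //; apply: measurable_minr => //.
exact: measurableT_comp.
Qed.

Lemma box_spline_ge0 x : 0 <= M x.
Proof. by rewrite mulr_ge0// le_min fine_ge0//= ler01. Qed.

Lemma box_spline_le1 x : M x <= 1.
Proof. by rewrite mulr_ile1// ?le_min ?fine_ge0 ?ler01// ge_min lexx orbT. Qed.

Lemma box_spline_support x : M x != 0 -> box_support x.
Proof.
rewrite /box_spline mulf_eq0 negb_or => /andP[_].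
by rewrite indicE; case: (boolP (x \in box_support)) => [/set_mem//|]; rewrite eqxx.
Qed.

Lemma integral_box_spline A : measurable A ->
  (\int[mu]_(x in A) (M x)%:E = nu A)%E.
Proof.
move=> mA; rewrite f_integral//; apply: ge0_ae_eq_integral => //.
- by apply/measurable_funTS/measurable_EFinP; exact: measurable_box_spline.
- exact: measurable_funTS.
- by move=> x _; rewrite lee_fin box_spline_ge0.
apply: filterS2 f_support f_le1 => x fS f1 _; rewrite /box_spline.
have [xS|xS] := pselect (box_support x).
  rewrite indicE mem_set// mulr1 min_l ?fineK//.
  by rewrite -lee_fin fineK.
by rewrite indicE memNset// mulr0 fS.
Qed.

Lemma integrable_box_spline : mu.-integrable setT (EFin \o M).
Proof.
apply/integrableP; split; first by apply/measurable_EFinP; exact: measurable_box_spline.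
under eq_integral do rewrite /= ger0_norm ?box_spline_ge0//.
by rewrite integral_box_spline// box_measure_setT ltry.
Qed.

Lemma Rintegral_box_spline : Rintegral mu setT M = 1.
Proof. by rewrite /Rintegral integral_box_spline// box_measure_setT. Qed.

Lemma integral_box_spline_affine (s : R) (c : 'cV[R]_d) A : 0 < s ->
  measurable A ->
  (\int[mu]_(x in A) (M (affine_cV s (- c) x))%:E =
   (s ^- d)%:E * nu (affine_cV s^-1 (s^-1 *: c) @^-1` A))%E.
Proof.
move=> s0 mA.
have mA' : measurable (affine_cV s^-1 (s^-1 *: c) @^-1` A).
  by rewrite -[X in measurable X]setTI; exact: measurable_affine_cV.
rewrite -integral_box_spline// [in RHS]integral_mkcond.
rewrite -(ge0_integral_affineV s0 (- c)); last 2 first.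
- apply/(measurable_restrictT _ mA')/measurable_funTS/measurable_EFinP.
  exact: measurable_box_spline.
- by move=> x; apply: erestrict_ge0 => y _; rewrite lee_fin box_spline_ge0.
rewrite integral_mkcond; apply: eq_integral => x _; rewrite !patchE.
have xE : affine_cV s^-1 (s^-1 *: c) (affine_cV s (- c) x) = x.
  by rewrite /affine_cV scalerDr scalerA mulVf ?gt_eqF// scale1r scalerN subrK.
have -> // : (affine_cV s (- c) x \in
    affine_cV s^-1 (s^-1 *: c) @^-1` A) = (x \in A).
by apply/idP/idP; rewrite !inE /= xE.
Qed.

(** Integrating the sum of translates over any A gives mu A. On each unit cube, where the constant 1
    is integrable, this identifies the sum with 1, and countably many unit cubes cover the space. *)
Lemma box_spline_partition : {ae mu, forall x,
  \esum_(k in [set: 'cV[int]_d]) (M (affine_cV 1 (- intcV k) x))%:E = 1%E}.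
Proof.
pose S x := \esum_(k in [set: 'cV[int]_d]) (M (affine_cV 1 (- intcV k) x))%:E.
have mM (k : 'cV[int]_d) : measurable_fun setT (fun x => (M (affine_cV 1 (- intcV k) x))%:E).
  apply/measurable_EFinP; apply: measurableT_comp; first exact: measurable_box_spline.
  exact: measurable_affine_cV.
have M0 (k : 'cV[int]_d) x : (0 <= (M (affine_cV 1 (- intcV k) x))%:E)%E.
  by rewrite lee_fin box_spline_ge0.
have mS : measurable_fun setT S by exact: measurable_esum.
have intS A : measurable A -> (\int[mu]_(x in A) S x = mu A)%E.
  move=> mA; rewrite -(esum_translate_box_measure P2 dn)//.
  rewrite integral_mkcond.
  rewrite (eq_integral (fun x => \esum_(k in [set: 'cV[int]_d])
     ((fun x => (M (affine_cV 1 (- intcV k) x))%:E) \_ A) x)); last first.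
    move=> x _; rewrite patchE; case: ifPn => xA.
      by apply: eq_esum => k _; rewrite patchE xA.
    by rewrite esum1// => k _; rewrite patchE (negbTE xA).
  rewrite ge0_integral_esum.
  - apply: eq_esum => k _; rewrite -integral_mkcond integral_box_spline_affine//.
    by rewrite expr1n invr1 mul1e scale1r.
  - by move=> k; apply/(measurable_restrictT _ mA)/measurable_funTS.
  - by move=> k x; apply: erestrict_ge0.
suff H k : ae_eq mu (dcube 0 k) (cst 1%E) S.
  have : {ae mu, forall x, forall k : 'cV[int]_d, dcube 0 k x -> S x = 1%E}.
    by apply: ae_forall_countable => k; apply: filterS (H k) => x xk /xk.
  apply: filterS => x /(_ _ (dcube_floor 0 x)); exact.
apply: integral_ae_eq.
- exact: measurable_dcube.
- apply/integrableP; split => //.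
  rewrite integral_cst//; last exact: measurable_dcube.
  have Dk : (mu (dcube 0 k) < +oo)%E by rewrite lebesgue_cV_dcube ltry.
  by rewrite normr1 mul1e; exact: Dk.
- exact: measurable_funTS.
- by move=> E ED mE; rewrite intS// integral_cst// mul1e.
Qed.

(** Both sides have the same integral over every measurable set, by the refinement of the box
    measure; 2^d undoes the Jacobian of the dilation by 2. *)
Lemma box_spline_refine : {ae mu, forall x,
  M x = 2 ^+ d * 2 ^- n * \sum_(e : {ffun 'I_n -> bool})
    M (affine_cV 2 (- intcV (P *m bitcV e)) x)}.
Proof.
pose S x := 2 ^+ d * 2 ^- n * \sum_(e : {ffun 'I_n -> bool})
    M (affine_cV 2 (- intcV (P *m bitcV e)) x).
have mM (e : {ffun 'I_n -> bool}) :
    measurable_fun setT (fun x => M (affine_cV 2 (- intcV (P *m bitcV e)) x)).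
  apply: measurableT_comp; first exact: measurable_box_spline.
  exact: measurable_affine_cV.
suff : ae_eq mu setT (EFin \o M) (EFin \o S).
  by apply: filterS => x /(_ I) [].
apply: integral_ae_eq => //.
- exact: integrable_box_spline.
- by apply/measurable_EFinP; apply: measurable_funM => //; apply: measurable_sum.
move=> A _ mA; rewrite integral_box_spline// box_measure_refine//.
under [RHS]eq_integral do rewrite /= EFinM -sumEFin.
have c0 : 0 <= 2 ^+ d * 2 ^- n :> R by rewrite mulr_ge0 ?invr_ge0 ?exprn_ge0.
rewrite ge0_integralZl//; last 2 first.
- apply: emeasurable_sum => e; exact/measurable_funTS/measurable_EFinP.
- by move=> x _; apply: sume_ge0 => e _; rewrite lee_fin box_spline_ge0.
rewrite ge0_integral_sum//; last 2 first.
- by move=> e; exact/measurable_funTS/measurable_EFinP.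
- by move=> e x _; rewrite lee_fin box_spline_ge0.
under [in RHS]eq_bigr do rewrite integral_box_spline_affine//.
rewrite -ge0_sume_distrr//.
by rewrite muleA -EFinM mulrAC divff ?mul1r// expf_neq0// pnatr_eq0.
Qed.

End box_spline.

(** * Quasi-interpolation in L2 *)

Section square_integrable_real.
Context d (X : measurableType d) (R : realType).
Variable nu : {measure set X -> \bar R}.
Implicit Types f g w : X -> R.

Local Notation integrable_real f := (nu.-integrable setT (EFin \o f)).

(** Real-valued: box spline and framelets are real, so a complex function is later treated through
    its real and imaginary parts. *)
Definition sq_integrable f :=
  measurable_fun setT f /\ integrable_real (fun x => f x ^+ 2).

Definition sqnorm f : R := Rintegral nu setT (fun x => f x ^+ 2).

Lemma le_integrable_real f g : measurable_fun setT f -> integrable_real g ->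
  (forall x, `|f x| <= g x) -> integrable_real f.
Proof.
move=> mf ig fg; apply: le_integrable ig => //; first exact/measurable_EFinP.
by move=> x _ /=; rewrite lee_fin (le_trans (fg x))// ler_norm.
Qed.

Lemma integrable_realD f g : integrable_real f -> integrable_real g ->
  integrable_real (fun x => f x + g x).
Proof.
move=> fi gi; have := integrableD measurableT fi gi.
by apply: eq_integrable => // x _; rewrite /= EFinD.
Qed.

Lemma integrable_realZ (c : R) f : integrable_real f ->
  integrable_real (fun x => c * f x).
Proof.
move=> fi; have := integrableZl measurableT c fi.
by apply: eq_integrable => // x _; rewrite /= EFinM.
Qed.

Lemma integrable_realB f g : integrable_real f -> integrable_real g ->
  integrable_real (fun x => f x - g x).
Proof.
move=> fi gi; have := integrableB measurableT fi gi.
by apply: eq_integrable => // x _; rewrite /= EFinB.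
Qed.

Lemma integrable_real_sum (I : Type) (s : seq I) (F : I -> X -> R) :
  (forall i, integrable_real (F i)) ->
  integrable_real (fun x => \sum_(i <- s) F i x).
Proof.
move=> Fi; elim: s => [|i s IH].
  rewrite (_ : _ \o _ = cst 0%E); first exact: integrable0.
  by apply/funext => x /=; rewrite big_nil.
rewrite (_ : _ \o _ = EFin \o (fun x => F i x + \sum_(j <- s) F j x)).
  exact: integrable_realD.
by apply/funext => x /=; rewrite big_cons.
Qed.

Lemma Rintegral_sum (I : Type) (s : seq I) (F : I -> X -> R) :
  (forall i, integrable_real (F i)) ->
  Rintegral nu setT (fun x => \sum_(i <- s) F i x) =
  \sum_(i <- s) Rintegral nu setT (F i).
Proof.
move=> Fi; elim: s => [|i s IH].
  rewrite big_nil (@eq_Rintegral _ _ _ nu setT (fun=> 0)); last by move=> x _; rewrite big_nil.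
  by rewrite Rintegral_cst// mul0r.
rewrite big_cons -IH -RintegralD//; last exact: integrable_real_sum.
by apply: eq_Rintegral => x _; rewrite big_cons.
Qed.

Lemma integrableM_sq f g : sq_integrable f -> sq_integrable g ->
  integrable_real (fun x => f x * g x).
Proof.
move=> [mf fi] [mg gi].
apply: (@le_integrable_real _ (fun x => f x ^+ 2 + g x ^+ 2)).
- exact: measurable_funM.
- exact: integrable_realD.
- move=> x; rewrite normrM -[f x ^+ 2]real_normK ?num_real//.
  rewrite -[g x ^+ 2]real_normK ?num_real//.
  have := normr_ge0 (f x); have := normr_ge0 (g x); nra.
Qed.

Lemma sq_integrableD f g : sq_integrable f -> sq_integrable g ->
  sq_integrable (fun x => f x + g x).
Proof.
move=> f2 g2; have fg := integrableM_sq f2 g2; move: f2 g2 => [mf fi] [mg gi].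
split; first exact: measurable_funD.
rewrite (_ : (fun x => _) = fun x => f x ^+ 2 + 2 * (f x * g x) + g x ^+ 2); last first.
  by apply/funext => x; ring.
by apply: integrable_realD => //; apply: integrable_realD => //; exact: integrable_realZ.
Qed.

Lemma sq_integrableZ (c : R) f : sq_integrable f ->
  sq_integrable (fun x => c * f x).
Proof.
move=> [mf fi]; split; first exact: measurable_funM.
rewrite (_ : (fun x => _) = fun x => c ^+ 2 * (f x ^+ 2)); last first.
  by apply/funext => x; rewrite exprMn.
exact: integrable_realZ.
Qed.

Lemma sq_integrableB f g : sq_integrable f -> sq_integrable g ->
  sq_integrable (fun x => f x - g x).
Proof.
move=> f2 g2; rewrite (_ : (fun x => _) = fun x => f x + (-1) * g x).
  by apply: sq_integrableD => //; exact: sq_integrableZ.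
by apply/funext => x; rewrite mulN1r.
Qed.

Lemma sqnorm_parallelogram f g : sq_integrable f -> sq_integrable g ->
  sqnorm (fun x => f x + g x) + sqnorm (fun x => f x - g x) =
  2 * sqnorm f + 2 * sqnorm g.
Proof.
move=> f2 g2; rewrite /sqnorm.
have [_ fi] := f2; have [_ gi] := g2.
rewrite -RintegralD//; last 2 first.
- by have [] := sq_integrableD f2 g2.
- by have [] := sq_integrableB f2 g2.
rewrite -!RintegralZl// -RintegralD//; try exact: integrable_realZ.
by apply: eq_Rintegral => x _; ring.
Qed.

Lemma sqnormZ (c : R) f : sq_integrable f ->
  sqnorm (fun x => c * f x) = c ^+ 2 * sqnorm f.
Proof.
move=> [_ fi]; rewrite /sqnorm -RintegralZl//.
by apply: eq_Rintegral => x _; rewrite exprMn.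
Qed.

(** The integral of (f - c)^2 w is non-negative; the inequality is its expansion with c the w-mean
    of f. *)
Lemma weighted_cauchy_schwarz f w : integrable_real (fun x => f x ^+ 2 * w x) ->
  integrable_real (fun x => f x * w x) -> integrable_real w ->
  (forall x, 0 <= w x) -> 0 < Rintegral nu setT w ->
  Rintegral nu setT (fun x => f x * w x) ^+ 2 / Rintegral nu setT w <=
  Rintegral nu setT (fun x => f x ^+ 2 * w x).
Proof.
move=> ffw fw iw w0; set I := Rintegral nu setT w; set J := Rintegral _ _ _ => I0.
pose c := J / I.
have : 0 <= Rintegral nu setT (fun x => (f x - c) ^+ 2 * w x).
  by apply: Rintegral_ge0 => x _; rewrite mulr_ge0// sqr_ge0.
rewrite (@eq_Rintegral _ _ _ nu setT (fun x => f x ^+ 2 * w x - 2 * c * (f x * w x) +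
  c ^+ 2 * w x)); last by move=> x _; ring.
rewrite RintegralD//; last 2 first.
- by apply: integrable_realB => //; exact: integrable_realZ.
- exact: integrable_realZ.
rewrite RintegralB//; last exact: integrable_realZ.
rewrite !RintegralZl// -/I -/J.
have -> : 2 * c * J = 2 * (J ^+ 2 / I) by rewrite /c; field; rewrite gt_eqF.
have -> : c ^+ 2 * I = J ^+ 2 / I by rewrite /c; field; rewrite gt_eqF.
lra.
Qed.

End square_integrable_real.

Section sq_convergence.
Context d (X : measurableType d) (R : realType).
Variable nu : {measure set X -> \bar R}.

Lemma dominated_sqnorm_cvg (f F : X -> R) (g : (X -> R)^nat) :
  measurable_fun setT f -> (forall n, measurable_fun setT (g n)) ->
  nu.-integrable setT (EFin \o F) ->
  (forall x n, (f x - g n x) ^+ 2 <= F x) ->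
  (forall x, g n x @[n --> \oo] --> f x) ->
  forall e, 0 < e -> exists n, sqnorm nu (fun x => f x - g n x) <= e.
Proof.
move=> mf mg iF fgF gf e e0.
have mfg n : measurable_fun setT (fun x => ((f x - g n x) ^+ 2)%:E).
  apply/measurable_EFinP; apply: measurable_funX; exact: measurable_funB.
have h0 : {ae nu, forall x, setT x ->
    ((f x - g n x) ^+ 2)%:E @[n --> \oo] --> cst 0%E x}.
  apply: aeW => x _.
  have fgc : f x - g n x @[n --> \oo] --> (0 : R).
    by rewrite -(subrr (f x)); apply: cvgB; [exact: cvg_cst|exact: gf].
  have fg2 : (f x - g n x) ^+ 2 @[n --> \oo] --> (0 : R).
    by rewrite -(mulr0 (0 : R)); exact: cvgM.
  by apply: cvg_EFin => //; near=> n.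
have hF : {ae nu, forall x n, setT x ->
    (`|((f x - g n x) ^+ 2)%:E| <= (EFin \o F) x)%E}.
  by apply: aeW => x n _; rewrite /= lee_fin ger0_norm ?sqr_ge0.
have [_ _] := dominated_convergence measurableT mfg (measurable_cst _) h0 iF hF.
rewrite integral0 => /fine_cvgP[_ /cvgrPdist_le/(_ _ e0)[N _ HN]].
exists N; have := HN N (leqnn _); rewrite sub0r normrN /sqnorm /Rintegral.
by apply: le_trans; exact: ler_norm.
Unshelve. all: by end_near. Qed.

End sq_convergence.

(** * Density of the indicators of boxes in L2 *)

Section density.
Import HBNNSimple.
Context {R : realType}.
Variable d : nat.
Local Notation mu := (@lebesgue_cV R d).
Local Notation sym_box m := (@hbox R d (fun=> - m%:R) (fun=> m%:R)).

(** The upper end is raised to the lower one where necessary, so that an empty intersection is still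
    a box with ordered ends. *)
Lemma hbox_setI (a b a' b' : 'I_d -> R) : hbox a b `&` hbox a' b' =
  hbox (fun i => Num.max (a i) (a' i))
       (fun i => Num.max (Num.max (a i) (a' i)) (Num.min (b i) (b' i))).
Proof.
apply/seteqP; split => x /=.
  move=> [xab xab'] i; have /andP[? ?] := xab i; have /andP[? ?] := xab' i.
  by rewrite ge_max lt_max lt_min; apply/andP; split; first exact/andP;
    apply/orP; right; exact/andP.
move=> H; split => i; have /andP[h1] := H i;
  rewrite lt_max ltNge h1 /= lt_min => /andP[hb hb'];
  by move: h1; rewrite ge_max => /andP[ha ha']; apply/andP.
Qed.

Lemma sym_box_le m (i : 'I_d) : - m%:R <= m%:R :> R.
Proof. by rewrite (@le_trans _ _ 0) ?oppr_le0. Qed.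

Lemma sym_box_cover (x : 'cV[R]_d) : exists m0, forall m, (m0 <= m)%N -> sym_box m x.
Proof.
have [m0 Hm0] : exists m0 : nat, forall i, `|x i 0| < m0%:R.
  exists (\max_i (Num.trunc `|x i ord0|).+1)%N => i.
  have := truncnS_gt `|x i 0|; move/lt_le_trans; apply.
  by rewrite ler_nat; exact: (leq_bigmax (F := fun i => (Num.trunc `|x i ord0|).+1)).
exists m0 => m mm0 i; have := lt_le_trans (Hm0 i) (_ : m0%:R <= m%:R).
by rewrite ler_nat => /(_ mm0); rewrite ltr_norml => /andP[/ltW -> ->].
Qed.

Lemma integrable_indic_box (a b : 'I_d -> R) : (forall i, a i <= b i) ->
  mu.-integrable setT (EFin \o (\1_(hbox a b) : 'cV[R]_d -> R)).
Proof.
move=> ab; apply/integrableP; split.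
  apply/measurable_EFinP; apply: measurable_indic; exact: measurable_hbox.
under eq_integral do rewrite /= ger0_norm//.
rewrite integral_indic//; last exact: measurable_hbox.
by rewrite setIT (le_lt_trans (y := (\prod_(i < d) (b i - a i))%:E)) ?ltry// -lebesgue_cV_hbox.
Qed.

(* A pi-lambda argument over the dyadic cubes, then simple functions. *)
Lemma sq_integrable_density (G : ('cV[R]_d -> R) -> Prop) :
  (forall f g, G f -> G g -> G (fun x => f x + g x)) ->
  (forall c f, G f -> G (fun x => c * f x)) ->
  (forall f, sq_integrable mu f ->
    (forall e, 0 < e -> exists g, G g /\ sqnorm mu (fun x => f x - g x) <= e) ->
    G f) ->
  (forall a b, (forall i, a i <= b i) -> G \1_(hbox a b)) ->
  forall f, sq_integrable mu f -> G f.
Proof.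
move=> GD GZ Gl Gb.
have G0 : G (fun=> 0).
  rewrite (_ : (fun=> 0) = fun x => 0 * \1_(sym_box 0%N) x).
    by apply/GZ/Gb => i; exact: sym_box_le.
  by apply/funext => x; rewrite mul0r.
have Gsum (I : Type) (s : seq I) (F : I -> 'cV[R]_d -> R) : (forall i, G (F i)) ->
    G (fun x => \sum_(i <- s) F i x).
  move=> GF; elim: s => [|i s IH].
    by rewrite (_ : (fun x => _) = fun=> 0)//; apply/funext => x; rewrite big_nil.
  rewrite (_ : (fun x => _) = fun x => F i x + \sum_(j <- s) F j x).
    exact: GD.
  by apply/funext => x; rewrite big_cons.
(* Sets are cut by a bounded box, since a measurable set may have infinite measure. *)
have sq_indic A m : measurable A -> sq_integrable mu (\1_(A `&` sym_box m)).
  move=> mA.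
  have mI : measurable_fun setT (\1_(A `&` sym_box m) : 'cV[R]_d -> R).
    by apply: measurable_indic; apply: measurableI => //; exact: measurable_hbox.
  split => //; apply: le_integrable_real (integrable_indic_box (@sym_box_le m)) _.
    exact: measurable_funX.
  move=> x; rewrite ger0_norm ?sqr_ge0// !indicE in_setI.
  by do 2 case: (x \in _); rewrite ?expr1n ?expr0n.
have Gindic A m : measurable A -> G \1_(A `&` sym_box m).
  rewrite measurable_cV_dyadic; move: A.
  apply: dynkin_induction.
  - exact: measurable_cV_dyadic.
  - exact: dyadic_setI.
  - by rewrite setTI; apply: Gb; exact: sym_box_le.
  - move=> _ [->|[j [k ->]]].
      rewrite set0I (_ : \1_set0 = fun=> 0)//.
      by apply/funext => x; rewrite indicE in_set0.
    by rewrite dcube_hbox hbox_setI; apply: Gb => i; rewrite le_max lexx.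
  - move=> S mS GS.
    rewrite (_ : \1_(~` S `&` sym_box m) =
        fun x => \1_(sym_box m) x + (-1) * \1_(S `&` sym_box m) x).
      by apply: GD; [apply: Gb; exact: sym_box_le|exact: GZ].
    apply/funext => x; rewrite !indicE !in_setI in_setC mulN1r.
    by case: (x \in S); case: (x \in _); rewrite /= ?subrr ?subr0.
  - move=> F mF tF GF.
    have mU : measurable (\bigcup_k F k) by exact: bigcup_measurable.
    apply: Gl; first exact: sq_indic.
    move=> e e0.
    pose g N x := \sum_(0 <= i < N) \1_(F i `&` sym_box m) x : R.
    suff [N gN] : exists N, sqnorm mu (fun x =>
        \1_(\bigcup_k F k `&` sym_box m) x - g N x) <= e.
      by exists (g N); split => //; apply: Gsum.
    (* By disjointness at most one summand is nonzero at [x], so the partial sums are eventually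
       constant there. *)
    have gE x i0 N : F i0 x -> g N x = \1_(sym_box m) x *+ (i0 < N)%N.
      move=> Fi0; rewrite /g big_mkord.
      have zero i : i != i0 -> \1_(F i `&` sym_box m) x = 0 :> R.
        move=> ii0; rewrite indicE in_setI memNset// => Fi.
        by move/eqP: ii0; apply; apply: tF => //; exists x.
      case: ltnP => i0N.
        rewrite (bigD1 (Ordinal i0N))//= big1 ?addr0; last first.
          by move=> i ii0; apply: zero; apply: contra ii0 => /eqP ii0; apply/eqP/val_inj.
        by rewrite !indicE in_setI mem_set.
      by rewrite big1// => i _; apply: zero; rewrite neq_ltn (leq_trans _ i0N)// ltn_ord.
    have gE0 x N : ~ (\bigcup_k F k) x -> g N x = 0.
      move=> nF; rewrite /g big1// => i _; rewrite indicE in_setI memNset// => Fi.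
      by apply: nF; exists i.
    have UE x i0 : F i0 x ->
        \1_(\bigcup_k F k `&` sym_box m) x = \1_(sym_box m) x :> R.
      by move=> Fi0; rewrite !indicE in_setI mem_set//; exists i0.
    have UE0 x : ~ (\bigcup_k F k) x -> \1_(\bigcup_k F k `&` sym_box m) x = 0 :> R.
      by move=> nF; rewrite indicE in_setI memNset.
    apply: (dominated_sqnorm_cvg _ _ (integrable_indic_box (@sym_box_le m))) => //.
    + by have [] := sq_indic _ m mU.
    + by move=> N; apply: measurable_sum => i; have [] := sq_indic _ m (mF i).
    + move=> x N; have [[i0 _ Fi0]|nF] := pselect ((\bigcup_k F k) x).
        rewrite (UE _ _ Fi0) (gE _ _ _ Fi0) !indicE.
        by case: (_ \in _); case: (_ < _)%N;
          rewrite ?mulr1n ?mulr0n ?subrr ?subr0 ?expr0n ?expr1n.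
      by rewrite UE0// gE0// subr0 expr0n.
    + move=> x; have [[i0 _ Fi0]|nF] := pselect ((\bigcup_k F k) x).
        apply: cvg_near_cst; exists i0.+1 => // N /= i0N.
        by rewrite (UE _ _ Fi0) (gE _ _ _ Fi0) i0N.
      apply: cvg_near_cst; apply: nearW => N.
      by rewrite UE0// gE0.
have Gpos f : sq_integrable mu f -> (forall x, 0 <= f x) -> G f.
  move=> f2 f0; have [mf fi] := f2; apply: Gl => // e e0.
  have mEf : measurable_fun setT (EFin \o f) by exact/measurable_EFinP.
  pose h n := nnsfun_approx measurableT mEf n.
  (* Cutting by growing boxes makes every level set one to which [Gindic] applies, and keeps the
     pointwise limit. *)
  pose g n x := h n x * \1_(sym_box n) x.
  have Ef0 x : setT x -> (0 <= (EFin \o f) x)%E by rewrite /= lee_fin.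
  have hf x : h n x @[n --> \oo] --> f x.
    have := @cvg_nnsfun_approx _ _ _ _ measurableT _ mEf Ef0 x I.
    by move/fine_cvgP => [_].
  have h_le n x : h n x <= f x.
    have := @le_approx _ _ _ setT (EFin \o f) n x Ef0 I.
    by rewrite /h nnsfun_approxE lee_fin.
  have Gg n : G (g n).
    have -> : g n = fun x => \sum_(y <- finmap.enum_fset (fset_set (range (h n))))
        y * \1_((h n @^-1` [set y]) `&` sym_box n) x.
      apply/funext => x; rewrite /g fimfunE fsbig_finite//= big_distrl/=.
      apply: eq_bigr => y _; rewrite -mulrA !indicE in_setI; congr (_ * _).
      by case: (_ \in _); case: (_ \in _); rewrite ?mulr1 ?mulr0 ?mul0r.
    by apply: Gsum => y; apply: GZ; apply: Gindic; exact: measurable_sfunP.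
  have [n gn] : exists n, sqnorm mu (fun x => f x - g n x) <= e.
    apply: (dominated_sqnorm_cvg _ _ fi) => //.
    - move=> n; apply: measurable_funM => //; apply: measurable_indic.
      exact: measurable_hbox.
    - move=> x n; rewrite /g indicE; have := h_le n x; have := f0 x.
      have : 0 <= h n x by [].
      by case: (_ \in _); rewrite ?mulr1 ?mulr0; nra.
    - move=> x; have [m0 Hm0] := sym_box_cover x.
      apply: cvg_trans (hf x); apply: near_eq_cvg.
      by exists m0 => // n /= /Hm0 xn; rewrite /g indicE mem_set// mulr1.
  by exists (g n).
move=> f f2; have [mf fi] := f2.
have [p2 n2] : sq_integrable mu (fun x => Num.max (f x) 0) /\
    sq_integrable mu (fun x => Num.max (- f x) 0).
  split; split.
  - by apply: measurable_maxr.
  - apply: le_integrable_real fi _; first by apply: measurable_funX; by apply: measurable_maxr.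
    move=> x; rewrite ger0_norm ?sqr_ge0//; case: (leP (f x) 0) => _ //.
    by rewrite expr0n/= sqr_ge0.
  - by apply: measurable_maxr => //; exact: measurableT_comp.
  - apply: le_integrable_real fi _.
      by apply: measurable_funX; apply: measurable_maxr => //; exact: measurableT_comp.
    move=> x; rewrite ger0_norm ?sqr_ge0//; case: (leP (- f x) 0) => _.
      by rewrite expr0n/= sqr_ge0.
    by rewrite sqrrN.
rewrite (_ : f = fun x => Num.max (f x) 0 + (-1) * Num.max (- f x) 0).
  apply: GD; first by apply: Gpos => // x; rewrite le_max lexx orbT.
  by apply: GZ; apply: Gpos => // x; rewrite le_max lexx orbT.
apply/funext => x; rewrite mulN1r.
by case: (leP (f x) 0) => fx; [rewrite max_l ?oppr_ge0// opprK add0r|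
  rewrite max_r ?oppr_le0 ?ltW// subr0].
Qed.

End density.

(** * Energies sampled by a compactly supported partition of unity *)

Section quasi_interpolation.
Context {R : realType}.
Variables (d : nat) (M : 'cV[R]_d -> R) (rho : R).
Local Notation mu := (@lebesgue_cV R d).
Hypothesis measurable_M : measurable_fun setT M.
Hypothesis M_ge0 : forall x, 0 <= M x.
Hypothesis M_le1 : forall x, M x <= 1.
Hypothesis integrable_M : mu.-integrable setT (EFin \o M).
Hypothesis Rintegral_M : Rintegral mu setT M = 1.
Hypothesis M_support : forall x, M x != 0 -> forall i, `|x i ord0| <= rho.
Hypothesis M_partition : {ae mu, forall x,
  \esum_(k in [set: 'cV[int]_d]) (M (affine_cV 1 (- intcV k) x))%:E = 1%E}.
Implicit Types (f g : 'cV[R]_d -> R) (J : nat) (k : 'cV[int]_d).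

Definition scaled_translate J k x : R := M (affine_cV (2 ^+ J) (- intcV k) x).
Local Notation w := scaled_translate.

Let w_ge0 J k x : 0 <= w J k x. Proof. exact: M_ge0. Qed.

Let w_le1 J k x : w J k x <= 1. Proof. exact: M_le1. Qed.

Let two_gt0 J : 0 < 2 ^+ J :> R. Proof. by rewrite exprn_gt0. Qed.

Lemma measurable_scaled_translate J k : measurable_fun setT (w J k).
Proof. exact: measurableT_comp (measurable_affine_cV _ _). Qed.

Lemma integrable_scaled_translate J k : mu.-integrable setT (EFin \o w J k).
Proof. exact: integrable_affine integrable_M. Qed.

Lemma Rintegral_scaled_translate J k :
  Rintegral mu setT (w J k) = (2 ^+ J) ^- d.
Proof.
have := Rintegral_affine (two_gt0 J) (- intcV k) integrable_M.
by rewrite Rintegral_M mulr1.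
Qed.

Lemma sq_integrable_scaled_translate J k : sq_integrable mu (w J k).
Proof.
split; first exact: measurable_scaled_translate.
apply: le_integrable_real (integrable_scaled_translate J k) _.
  by apply: measurable_funX; exact: measurable_scaled_translate.
by move=> x; rewrite ger0_norm ?sqr_ge0// expr2 ler_piMr.
Qed.

Lemma ae_partition_scaled J : {ae mu, forall x,
  \esum_(k in [set: 'cV[int]_d]) (w J k x)%:E = 1%E}.
Proof.
have := ae_affine (two_gt0 J) 0 M_partition; apply: filterS => x <-.
by apply: eq_esum => k _; rewrite /w /affine_cV scale1r addr0.
Qed.

(** Tonelli, then the partition of unity at scale 2^-J under the integral. *)
Lemma esum_integral_scaled J f : measurable_fun setT f -> (forall x, 0 <= f x) ->
  (\esum_(k in [set: 'cV[int]_d]) \int[mu]_x (f x * w J k x)%:E =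
   \int[mu]_x (f x)%:E)%E.
Proof.
move=> mf f0; rewrite -ge0_integral_esum; last 2 first.
- move=> k; apply/measurable_EFinP/measurable_funM => //.
  exact: measurable_scaled_translate.
- by move=> k x; rewrite lee_fin mulr_ge0.
apply: ge0_ae_eq_integral => //.
- apply: measurable_esum => [k|k x]; last by rewrite lee_fin mulr_ge0.
  apply/measurable_EFinP/measurable_funM => //.
  exact: measurable_scaled_translate.
- exact/measurable_EFinP.
- by move=> x _; apply: esum_ge0 => k _; rewrite lee_fin mulr_ge0.
- by move=> x _; rewrite lee_fin.
apply: filterS (ae_partition_scaled J) => x px _.
by rewrite -[RHS]mule1 -px -esumZl// => k; rewrite lee_fin.
Qed.

Definition coef f J k : R := Rintegral mu setT (fun x => f x * w J k x).

(** The Q_J(f) of the overview; the weight is the square of the normalisation 2^(Jd/2) of a dilated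
    translate. *)
Definition sampled_energy J f : \bar R :=
  \esum_(k in [set: 'cV[int]_d]) ((2 ^+ J) ^+ d * coef f J k ^+ 2)%:E.

Let weight_ge0 J : 0 <= (2 ^+ J) ^+ d :> R.
Proof. by rewrite !exprn_ge0. Qed.

Let summand_ge0 J f k : (0 <= ((2 ^+ J) ^+ d * coef f J k ^+ 2)%:E)%E.
Proof. by rewrite lee_fin mulr_ge0// sqr_ge0. Qed.

Lemma sampled_energy_ge0 J f : (0 <= sampled_energy J f)%E.
Proof. by apply: esum_ge0 => k _. Qed.

Lemma integrable_coef f J k : sq_integrable mu f ->
  mu.-integrable setT (EFin \o (fun x => f x * w J k x)).
Proof. by move=> f2; apply: integrableM_sq => //; exact: sq_integrable_scaled_translate. Qed.

Lemma coefD f g J k : sq_integrable mu f -> sq_integrable mu g ->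
  coef (fun x => f x + g x) J k = coef f J k + coef g J k.
Proof.
move=> f2 g2; rewrite /coef -RintegralD//; try exact: integrable_coef.
by apply: eq_Rintegral => x _; rewrite mulrDl.
Qed.

Lemma coefZ (c : R) f J k : sq_integrable mu f ->
  coef (fun x => c * f x) J k = c * coef f J k.
Proof.
move=> f2; rewrite /coef -RintegralZl//; last exact: integrable_coef.
by apply: eq_Rintegral => x _; rewrite mulrA.
Qed.

Lemma coefB f g J k : sq_integrable mu f -> sq_integrable mu g ->
  coef (fun x => f x - g x) J k = coef f J k - coef g J k.
Proof.
move=> f2 g2; rewrite /coef -RintegralB//; try exact: integrable_coef.
by apply: eq_Rintegral => x _; rewrite mulrBl.
Qed.

Lemma sqnormE f : sq_integrable mu f ->
  (sqnorm mu f)%:E = (\int[mu]_x (f x ^+ 2)%:E)%E.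
Proof. by move=> [_ fi]; rewrite fineK//; exact: integrable_fin_num. Qed.

(** Cauchy-Schwarz with respect to the weight [w J k], whose mass cancels the normalisation, bounds
    one summand by the integral of f^2 [w J k]; these integrals add up to the norm. *)
Lemma bessel J f : sq_integrable mu f -> (sampled_energy J f <= (sqnorm mu f)%:E)%E.
Proof.
move=> f2; have [mf fi] := f2.
rewrite sqnormE// -(esum_integral_scaled J); last 2 first.
- exact: measurable_funX.
- by move=> x; exact: sqr_ge0.
apply: le_esum => k _.
have ffw : mu.-integrable setT (EFin \o (fun x => f x ^+ 2 * w J k x)).
  apply: le_integrable_real fi _.
    by apply: measurable_funM; [exact: measurable_funX|exact: measurable_scaled_translate].
  move=> x; have f0 := sqr_ge0 (f x).
  by rewrite ger0_norm; [rewrite ler_piMr|rewrite (mulr_ge0 f0)].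
rewrite -[leRHS]fineK; last exact: integrable_fin_num ffw.
rewrite lee_fin.
have := weighted_cauchy_schwarz ffw (integrable_coef J k f2)
  (integrable_scaled_translate J k).
rewrite Rintegral_scaled_translate invrK mulrC; apply.
- by move=> x; exact: M_ge0.
- by rewrite invr_gt0 exprn_gt0.
Qed.

Definition defect J f : R := sqnorm mu f - fine (sampled_energy J f).

Lemma sampled_energy_fin J f : sq_integrable mu f ->
  sampled_energy J f \is a fin_num.
Proof.
move=> f2; rewrite ge0_fin_numE ?sampled_energy_ge0//.
by apply: le_lt_trans (bessel J f2) _; rewrite ltry.
Qed.

Lemma defect_ge0 J f : sq_integrable mu f -> 0 <= defect J f.
Proof.
move=> f2; rewrite subr_ge0 -lee_fin fineK ?sampled_energy_fin//.
exact: bessel.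
Qed.

Lemma defect_le J f : defect J f <= sqnorm mu f.
Proof. by rewrite lerBlDr lerDl fine_ge0// sampled_energy_ge0. Qed.

Lemma defectZ (c : R) J f : sq_integrable mu f ->
  defect J (fun x => c * f x) = c ^+ 2 * defect J f.
Proof.
move=> f2; rewrite /defect sqnormZ// mulrBr; congr (_ - _).
have -> : (sampled_energy J (fun x => c * f x)%R =
    (c ^+ 2)%:E * sampled_energy J f)%E.
  rewrite -esumZl ?sqr_ge0//; apply: eq_esum => k _.
  by rewrite coefZ// exprMn -EFinM mulrCA.
by rewrite fineM// sampled_energy_fin.
Qed.

Lemma defect_parallelogram J f g : sq_integrable mu f -> sq_integrable mu g ->
  defect J (fun x => f x + g x) + defect J (fun x => f x - g x) =
  2 * defect J f + 2 * defect J g.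
Proof.
move=> f2 g2; have fgD := sq_integrableD f2 g2; have fgB := sq_integrableB f2 g2.
have H : (sampled_energy J (fun x => f x + g x)%R +
    sampled_energy J (fun x => f x - g x)%R =
    2%:E * sampled_energy J f + 2%:E * sampled_energy J g)%E.
  rewrite -!esumZl// -!esumD//; try by move=> k _; rewrite mule_ge0.
  apply: eq_esum => k _; rewrite coefD// coefB// -!EFinM -!EFinD.
  by congr EFin; ring.
have := congr1 fine H.
rewrite !fineD ?fin_numM ?sampled_energy_fin//.
rewrite [fine (2%:E * _)]fineM ?sampled_energy_fin//.
rewrite [fine (2%:E * sampled_energy J g)]fineM ?sampled_energy_fin// => e.
have := sqnorm_parallelogram f2 g2; rewrite /defect; move: e; lra.
Qed.

Lemma defectD J f g : sq_integrable mu f -> sq_integrable mu g ->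
  defect J (fun x => f x + g x) <= 2 * defect J f + 2 * defect J g.
Proof.
move=> f2 g2; rewrite -defect_parallelogram// lerDl.
exact/defect_ge0/sq_integrableB.
Qed.

Let vanishing f := sq_integrable mu f /\
  forall e, 0 < e -> exists J0, forall J, (J0 <= J)%N -> defect J f <= e.

Let vanishingD f g : vanishing f -> vanishing g -> vanishing (fun x => f x + g x).
Proof.
move=> [f2 fv] [g2 gv]; split; first exact: sq_integrableD.
move=> e e0; have e4 : 0 < e / 4 by rewrite divr_gt0.
have [Jf Hf] := fv _ e4; have [Jg Hg] := gv _ e4.
exists (maxn Jf Jg) => J; rewrite geq_max => /andP[/Hf hf /Hg hg].
have := defectD J f2 g2; move: hf hg; lra.
Qed.

Let vanishingZ (c : R) f : vanishing f -> vanishing (fun x => c * f x).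
Proof.
move=> [f2 fv]; split; first exact: sq_integrableZ.
move=> e e0; have ec : 0 < e / (c ^+ 2 + 1).
  by rewrite divr_gt0// ltr_wpDl// sqr_ge0.
have [J0 HJ] := fv _ ec; exists J0 => J /HJ h; rewrite defectZ//.
have c1 : 0 < c ^+ 2 + 1 by rewrite ltr_wpDl// sqr_ge0.
move: h; rewrite ler_pdivlMr// => h.
have := defect_ge0 J f2; have := sqr_ge0 c; nra.
Qed.

(** Write f = g + (f - g): the defect of g is eventually small and that of f - g is at most its
    norm, uniformly in J. Two terms, each doubled, explain e / 4. *)
Let vanishing_closed f : sq_integrable mu f ->
  (forall e, 0 < e -> exists g, vanishing g /\ sqnorm mu (fun x => f x - g x) <= e) ->
  vanishing f.
Proof.
move=> f2 fg; split => // e e0; have e4 : 0 < e / 4 by rewrite divr_gt0.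
have [g [[g2 gv] fge]] := fg _ e4; have [J0 HJ] := gv _ e4.
exists J0 => J /HJ h; have fg2 := sq_integrableB f2 g2.
have := defectD J g2 fg2; have := defect_le J (fun x => f x - g x).
rewrite (_ : (fun x => g x + (f x - g x)) = f); last by apply/funext => x; rewrite addrC subrK.
move: h fge; lra.
Qed.

Section box_defect.
Variables (a b : 'I_d -> R).
Hypothesis ab : forall i, a i <= b i.

(** Two points of the support of one translate lie within rho / 2^J of its centre in each
    coordinate, hence within twice that of each other. *)
Let margin J : R := 2 * rho / 2 ^+ J.

Let inner_a J i := a i + margin J.
(** The maximum lets the shrunken box degenerate to an empty one while the margin is still too
    wide. *)
Let inner_b J i := Num.max (inner_a J i) (b i - margin J).

Let sq_indic : sq_integrable mu (\1_(hbox a b) : 'cV[R]_d -> R).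
Proof.
split; first by apply: measurable_indic; exact: measurable_hbox.
apply: le_integrable_real (integrable_indic_box ab) _.
  by apply: measurable_funX; apply: measurable_indic; exact: measurable_hbox.
move=> x; rewrite ger0_norm ?sqr_ge0// indicE.
by case: (_ \in _); rewrite ?expr1n ?expr0n.
Qed.

Let sqnorm_indic : sqnorm mu (\1_(hbox a b)) = \prod_(i < d) (b i - a i).
Proof.
rewrite /sqnorm /Rintegral (eq_integral (EFin \o \1_(hbox a b))); last first.
  by move=> x _; rewrite /= indicE; case: (_ \in _); rewrite ?expr1n ?expr0n.
rewrite integral_indic//; last exact: measurable_hbox.
by rewrite setIT -[RHS]/(fine _%:E) -lebesgue_cV_hbox.
Qed.

Let inner_support J k x y : hbox (inner_a J) (inner_b J) x -> w J k x != 0 ->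
  w J k y != 0 -> hbox a b y.
Proof.
move=> xA /M_support xs /M_support ys i.
have /andP[] := xA i; rewrite /inner_b lt_max => ax.
rewrite ltNge ax /= => xb.
have := xs i; have := ys i; rewrite !mxE !ler_norml => /andP[y1 y2] /andP[x1 x2].
have mE : margin J * 2 ^+ J = 2 * rho by rewrite /margin divfK// gt_eqF.
move: ax; rewrite /inner_a => ax; have J0 := two_gt0 J.
apply/andP; split.
  rewrite -(ler_pM2l J0).
  have : 2 ^+ J * (a i + margin J) <= 2 ^+ J * x i ord0 by rewrite ler_pM2l.
  by rewrite mulrDr [2 ^+ J * margin J]mulrC mE; lra.
rewrite -(ltr_pM2l J0).
have : 2 ^+ J * x i ord0 < 2 ^+ J * (b i - margin J) by rewrite ltr_pM2l.
by rewrite mulrBr [2 ^+ J * margin J]mulrC mE; lra.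
Qed.

(* If the support of the k-th translate meets the shrunken box, it lies in the box,
   where the coefficient is computed exactly. *)
Let energy_lower J : ((\prod_(i < d) (inner_b J i - inner_a J i))%:E <=
  sampled_energy J \1_(hbox a b))%E.
Proof.
have mA : measurable (hbox (inner_a J) (inner_b J)) by exact: measurable_hbox.
rewrite -lebesgue_cV_hbox; last by move=> i; rewrite le_max lexx.
rewrite -[X in lebesgue_cV d X]setIT -integral_indic//.
have mI : measurable_fun setT (\1_(hbox (inner_a J) (inner_b J)) : 'cV[R]_d -> R).
  exact: measurable_indic.
rewrite -(esum_integral_scaled J mI)//.
apply: le_esum => k _.
have [[x [xA wx]]|nx] :=
    pselect (exists x, hbox (inner_a J) (inner_b J) x /\ w J k x != 0).
  have -> : coef \1_(hbox a b) J k = (2 ^+ J) ^- d.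
    rewrite -(Rintegral_scaled_translate J k) /coef; apply: eq_Rintegral => y _.
    rewrite -[RHS]/(w J k y).
    have [->|wy] := eqVneq (w J k y) 0; first by rewrite mulr0.
    have yA := inner_support xA wx wy.
    by rewrite indicE mem_set// mul1r.
  (* The summand is thus the whole mass of the translate, which dominates its part over the shrunken
     box. *)
  have -> : (2 ^+ J) ^+ d * (2 ^+ J) ^- d ^+ 2 = (2 ^+ J) ^- d :> R.
    by rewrite expr2 mulrA divff ?mul1r// expf_neq0// expf_neq0.
  rewrite -(Rintegral_scaled_translate J k) /Rintegral fineK; last first.
    by apply: integrable_fin_num => //; exact: integrable_scaled_translate.
  apply: ge0_le_integral => //.
  - by move=> y _; rewrite lee_fin mulr_ge0.
  - apply/measurable_EFinP; apply: measurable_funM; first exact: measurable_indic.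
    exact: measurable_scaled_translate.
  - by apply/measurable_EFinP; exact: measurable_scaled_translate.
  - by move=> y _; rewrite lee_fin ler_piMl// indicE; case: (_ \in _).
(* A translate that misses the shrunken box contributes 0 on the left. *)
rewrite integral0_eq//; move=> y _; rewrite indicE.
case: (boolP (_ \in _)) => [/set_mem yA|_]; last by rewrite mul0r.
have [->|wy] := eqVneq (w J k y) 0; first by rewrite mulr0.
by exfalso; apply: nx; exists y.
Qed.

Let margin_cvg0 : margin J @[J --> \oo] --> 0.
Proof.
rewrite (_ : (fun J => margin J) = fun J => (2 * rho) * (2^-1 ^+ J)); last first.
  by apply/funext => J; rewrite exprVn.
rewrite -(mulr0 (2 * rho)); apply: cvgM; first exact: cvg_cst.
by apply: cvg_expr; rewrite ger0_norm ?invr_ge0// invf_lt1// ltr1n.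
Qed.

Let inner_volume_cvg : \prod_(i < d) (inner_b J i - inner_a J i) @[J --> \oo]
  --> \prod_(i < d) (b i - a i).
Proof.
apply: cvg_big => // [|i _]; first exact: mul_continuous.
have ca : inner_a J i @[J --> \oo] --> a i.
  by rewrite -[a i in X in _ --> X]addr0; apply: cvgD; [exact: cvg_cst|].
have cb : b i - margin J @[J --> \oo] --> b i.
  by rewrite -[b i in X in _ --> X]subr0; apply: cvgB; [exact: cvg_cst|].
apply: cvgB => //.
suff : inner_b J i @[J --> \oo] --> Num.max (a i) (b i) by rewrite max_r.
rewrite /inner_b maxr_absE; under eq_fun do rewrite maxr_absE.
apply: cvgM; last exact: cvg_cst.
by apply: cvgD; [exact: cvgD|apply: cvg_norm; exact: cvgB].
Qed.

(** The energy is at least the volume of the shrunken box, which tends to that of the box, the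
    squared norm of the indicator. *)
Lemma vanishing_box : vanishing \1_(hbox a b).
Proof.
split => // e e0.
have /cvgrPdist_le/(_ _ e0)[J0 _ HJ] := inner_volume_cvg.
exists J0 => J /HJ/= h; rewrite /defect sqnorm_indic.
have := energy_lower J; rewrite -[sampled_energy _ _]fineK ?sampled_energy_fin//.
rewrite lee_fin => h2; apply: le_trans (le_trans (ler_norm _) h).
by rewrite lerD2l lerN2.
Qed.

End box_defect.

Theorem sampled_energy_cvg f : sq_integrable mu f ->
  sampled_energy J f @[J --> \oo] --> (sqnorm mu f)%:E.
Proof.
move=> f2.
have [_ fv] : vanishing f.
  apply: (sq_integrable_density (G := vanishing)) f2 => [g h|c g|g|a b].
  - exact: vanishingD.
  - exact: vanishingZ.
  - exact: vanishing_closed.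
  - exact: vanishing_box.
apply/fine_cvgP; split; first by apply: nearW => J; exact: sampled_energy_fin.
apply/cvgrPdist_le => e e0; have [J0 HJ] := fv _ e0.
exists J0 => // J /= /HJ; rewrite /defect => h.
by rewrite ger0_norm//; exact: defect_ge0.
Qed.

End quasi_interpolation.

(** * Telescoping of the framelet energies *)

Section framelet_energy.
Context {R : realType}.
Variables (d n s : nat) (P : 'M[int]_(d, n)) (g1 g2 : 'I_s -> 'cV[int]_n).
Hypothesis P2 : [set P^T *m k | k in ~` even_lattice d] `<=` ~` even_lattice n.
Hypothesis dn : (d <= n)%N.
Hypothesis gP : enumerates_pairs g1 g2.
Local Notation mu := (@lebesgue_cV R d).
Local Notation M := (@box_spline R d n P).
Local Notation c := (2 ^+ d * 2 ^- n : R).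
Implicit Types (f : 'cV[R]_d -> R) (j : nat) (k : 'cV[int]_d) (l : 'I_s).

(** The function with Fourier transform Pb_l(xi/2) phi(xi/2): 2^-n is the filter coefficient, and
    2^d compensates the dilation by 2. *)
Definition framelet l (x : 'cV[R]_d) : R :=
  2 ^+ d * 2 ^- n * (M (affine_cV 2 (- intcV (P *m g1 l)) x) -
                     M (affine_cV 2 (- intcV (P *m g2 l)) x)).

Definition framelet_coef f l j k : R :=
  Rintegral mu setT (fun x => f x * framelet l (affine_cV (2 ^+ j) (- intcV k) x)).

Let mM : measurable_fun setT M. Proof. exact: measurable_box_spline. Qed.

Let M0 x : 0 <= M x. Proof. exact: box_spline_ge0. Qed.

Let M1 x : M x <= 1. Proof. exact: box_spline_le1. Qed.

Let iM : mu.-integrable setT (EFin \o M).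
Proof. exact: integrable_box_spline. Qed.

Let IM : Rintegral mu setT M = 1. Proof. exact: Rintegral_box_spline. Qed.

Let pM : {ae mu, forall x,
  \esum_(k in [set: 'cV[int]_d]) (M (affine_cV 1 (- intcV k) x))%:E = 1%E}.
Proof. exact: box_spline_partition. Qed.

Let sM x : M x != 0 -> forall i, `|x i ord0| <= \sum_i box_radius P i.
Proof.
move=> /box_spline_support xS i; have := xS i; rewrite in_itv/= -ler_norml.
move=> /le_trans; apply; rewrite (bigD1 i)//= lerDl; apply: sumr_ge0 => i' _.
by apply: sumr_ge0 => j _; rewrite ler0z.
Qed.

Let integrable_coef_box f j k : sq_integrable mu f ->
  mu.-integrable setT (EFin \o (fun x => f x * scaled_translate M j k x)).
Proof. exact: integrable_coef. Qed.

Lemma affine_cV_comp2 j k (p : 'cV[int]_d) (x : 'cV[R]_d) :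
  affine_cV 2 (- intcV p) (affine_cV (2 ^+ j) (- intcV k) x) =
  affine_cV (2 ^+ j.+1) (- intcV ((2 : int) *: k + p)) x.
Proof.
rewrite /affine_cV scalerDr scalerA -exprS intcVD intcVZ scalerN opprD addrA.
by [].
Qed.

(** The refinement equation holds off a null set; its pullback under the dilation to level j is null
    too, so it may be used under the integral. *)
Lemma coef_refine f j k : sq_integrable mu f ->
  coef M f j k = c * \sum_(e : {ffun 'I_n -> bool})
    coef M f j.+1 ((2 : int) *: k + P *m bitcV e).
Proof.
move=> f2; have [mf _] := f2.
rewrite /coef -Rintegral_sum; last by move=> e; exact: integrable_coef_box.
rewrite -RintegralZl//; last by apply: integrable_real_sum => e; exact: integrable_coef_box.
rewrite /Rintegral; congr fine; apply: ae_eq_integral => //.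
- apply/measurable_EFinP; apply: measurable_funM => //.
  exact: measurable_scaled_translate.
- apply/measurable_EFinP; apply: measurable_funM => //; apply: measurable_sum => e.
  by apply: measurable_funM => //; exact: measurable_scaled_translate.
have j0 : 0 < 2 ^+ j :> R by rewrite exprn_gt0.
have := ae_affine j0 (- intcV k) (box_spline_refine P2 dn).
apply: filterS => x xE _; congr EFin; rewrite -big_distrr/= [RHS]mulrCA; congr (_ * _).
rewrite /scaled_translate xE; congr (_ * _); apply: eq_bigr => e _.
by rewrite affine_cV_comp2.
Qed.

Lemma framelet_coef_refine f l j k : sq_integrable mu f ->
  framelet_coef f l j k = c * (coef M f j.+1 ((2 : int) *: k + P *m g1 l) -
                               coef M f j.+1 ((2 : int) *: k + P *m g2 l)).
Proof.
move=> f2; rewrite /coef -RintegralB//; try exact: integrable_coef_box.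
rewrite -RintegralZl//; last first.
  by apply: integrable_realB; exact: integrable_coef_box.
apply: eq_Rintegral => x _; rewrite /framelet !affine_cV_comp2.
by rewrite /scaled_translate; ring.
Qed.

Definition framelet_energy j l f : \bar R :=
  \esum_(k in [set: 'cV[int]_d]) ((2 ^+ j) ^+ d * framelet_coef f l j k ^+ 2)%:E.

(** For each k, Lagrange's identity with [u = v] the coefficients at level j + 1 gives a sum over
    all bit vectors; summing over k, each coefficient appears 2^(n-d) times, and c 2^(n-d) = 1. *)
Lemma sampled_energy_step f j : sq_integrable mu f ->
  (sampled_energy M j f + \sum_(l < s) framelet_energy j l f =
   sampled_energy M j.+1 f)%E.
Proof.
move=> f2.
have w0 (i : nat) : 0 <= (2 ^+ i) ^+ d :> R by rewrite !exprn_ge0.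
rewrite -esum_sum; last by move=> k l _ _; rewrite lee_fin mulr_ge0 ?sqr_ge0.
rewrite -esumD; last 2 first.
- by move=> k _; rewrite lee_fin mulr_ge0 ?sqr_ge0.
- by move=> k _; apply: sume_ge0 => l _; rewrite lee_fin mulr_ge0 ?sqr_ge0.
pose g p := ((2 ^+ j.+1) ^+ d * coef M f j.+1 p ^+ 2)%:E.
transitivity (\esum_(k in [set: 'cV[int]_d]) (c%:E *
    \sum_(e : {ffun 'I_n -> bool}) g ((2 : int) *: k + P *m bitcV e)%R)%E).
  apply: eq_esum => k _; rewrite !sumEFin -EFinD -EFinM; congr EFin.
  rewrite -!big_distrr/= -mulrDr.
  pose u (p : 'cV[int]_n) := coef M f j.+1 ((2 : int) *: k + P *m p).
  rewrite coef_refine//.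
  rewrite [X in _ + X](eq_bigr (fun l => c ^+ 2 *
     ((u (g1 l) - u (g2 l)) * (u (g1 l) - u (g2 l))))); last first.
    by move=> l _; rewrite framelet_coef_refine// exprMn [(_ - _) ^+ 2]expr2.
  rewrite exprMn [X in _ * X + _]expr2 -big_distrr/= -mulrDr.
  rewrite (@lagrange_pairs _ _ _ _ gP _ u u).
  rewrite [in LHS](eq_bigr (fun e => u (bitcV e) ^+ 2)); last by move=> e _; rewrite expr2.
  rewrite !mulrA; congr (_ * _); rewrite exprS exprMn.
  by field; rewrite expf_neq0// pnatr_eq0.
have c0 : 0 <= c by rewrite mulr_ge0 ?invr_ge0 ?exprn_ge0.
have g0 p : (0 <= g p)%E by rewrite lee_fin mulr_ge0 ?sqr_ge0.
rewrite esumZl//; last by move=> k; apply: sume_ge0.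
rewrite esum_bits// muleA -EFinM -[in 2 ^- n](subnK dn) exprD.
rewrite (_ : _ * _ * _ = 1) ?mul1e//.
by field; rewrite !expf_neq0// pnatr_eq0.
Qed.

Lemma framelet_energy_ge0 j l f : (0 <= framelet_energy j l f)%E.
Proof. by apply: esum_ge0 => k _; rewrite lee_fin mulr_ge0 ?sqr_ge0 ?exprn_ge0. Qed.

Theorem framelet_energy_sum f : sq_integrable mu f ->
  ((sqnorm mu f)%:E = sampled_energy M 0 f +
     \sum_(0 <= j <oo) \sum_(l < s) framelet_energy j l f)%E.
Proof.
move=> f2.
have part J : (sampled_energy M 0 f + \sum_(0 <= j < J) \sum_(l < s) framelet_energy j l f
    = sampled_energy M J f)%E.
  elim: J => [|J IH]; first by rewrite big_geq// adde0.
  rewrite -(sampled_energy_step J f2) -IH big_nat_recr; last by [].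
  by rewrite -[RHS]addeA.
have lim1 := sampled_energy_cvg mM M0 M1 iM IM sM pM f2.
have fin0 : sampled_energy M 0 f \is a fin_num by exact: sampled_energy_fin.
have cv : cvgn (fun J => \sum_(0 <= j < J) \sum_(l < s) framelet_energy j l f)%E.
  by apply: is_cvg_nneseries => j _ _; apply: sume_ge0 => l _; exact: framelet_energy_ge0.
have lim2 : sampled_energy M J f @[J --> \oo] -->
   (sampled_energy M 0 f + \sum_(0 <= j <oo) \sum_(l < s) framelet_energy j l f)%E.
  rewrite (_ : (fun J => _) = fun J => (sampled_energy M 0 f +
      \sum_(0 <= j < J) \sum_(l < s) framelet_energy j l f)%E); last first.
    by apply/funext => J; rewrite part.
  apply: cvgeD => //; last exact: cvg_cst.
  (* Finiteness of the level 0 energy makes the sum of the two limits well defined. *)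
  by apply: fin_num_adde_defr.
exact: cvg_unique lim1 lim2.
Qed.

End framelet_energy.

(** * Fourier transforms *)

Section complex_limits.
Context {R : realType}.

Lemma norm_real_complex (r : R) : `|r%:C| = `|r|%:C.
Proof. by rewrite normc_def /= expr0n addr0 sqrtr_sqr. Qed.

Lemma norm_expi (t : R) : `|expi t| = 1.
Proof. by rewrite normc_def /= cos2Dsin2 sqrtr1. Qed.

Lemma cvg_real_complex (u : nat -> R) (l : R) : u N @[N --> \oo] --> l ->
  (u N)%:C @[N --> \oo] --> l%:C.
Proof.
move=> ul; apply/cvgrPdist_le => e; rewrite ltcE /= => /andP[/eqP e0 e1].
move/cvgrPdist_le : ul => /(_ _ e1); apply: filterS => N h.
by rewrite -rmorphB norm_real_complex lecE /= e0 eqxx.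
Qed.

Lemma cvg_complex (u v : nat -> R) (a b : R) : u N @[N --> \oo] --> a ->
  v N @[N --> \oo] --> b -> (u N +i* v N) @[N --> \oo] --> (a +i* b).
Proof.
move=> ua vb; rewrite (complexE (a +i* b)) /=.
rewrite (_ : (fun N => _) = fun N => (u N)%:C + 'i * (v N)%:C); last first.
  by apply/funext => N; rewrite [LHS]complexE.
apply: cvgD; first exact: cvg_real_complex.
by apply: cvgM; [exact: cvg_cst|exact: cvg_real_complex].
Qed.

(* The partial products have modulus at most 1, and multiplied by h(2^-N xi) they
   equal h xi. *)
Lemma refinable_infinite_product m (a h : 'cV[R]_m -> R[i]) (xi : 'cV[R]_m) :
  (forall x, `|a x| <= 1) -> (forall x, h x = a (2^-1 *: x) * h (2^-1 *: x)) ->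
  h (2 ^- N *: xi) @[N --> \oo] --> (1 : R[i]) ->
  \prod_(1 <= j < N.+1) a ((2 ^- j) *: xi) @[N --> \oo] --> h xi.
Proof.
move=> a1 hE h1.
have prodE N : \prod_(1 <= j < N.+1) a ((2 ^- j) *: xi) * h (2 ^- N *: xi) = h xi.
  elim: N => [|N IH]; first by rewrite big_geq// mul1r expr0 invr1 scale1r.
  rewrite big_nat_recr//= -IH -mulrA; congr (_ * _).
  by rewrite [RHS]hE !scalerA -invfM -exprS.
have prod1 N : `|\prod_(1 <= j < N.+1) a ((2 ^- j) *: xi)| <= 1.
  elim/big_ind: _ => [|x y hx hy|j _]; rewrite ?normr1// normrM.
  by rewrite mulr_ile1.
apply/cvgrPdist_le => e e0.
move/cvgrPdist_le : h1 => /(_ _ e0); apply: filterS => N hN.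
rewrite -(prodE N) -[X in _ - X]mulr1 -mulrBr normrM distrC.
by apply: le_trans hN; rewrite -[leRHS]mul1r ler_wpM2r.
Qed.

End complex_limits.

Section complex_integrals.
Context {R : realType}.
Variable d : nat.
Local Notation mu := (@lebesgue_cV R d).
Implicit Types F G : 'cV[R]_d -> R[i].

Lemma ReM (z w : R[i]) : complex.Re (z * w) =
  complex.Re z * complex.Re w - complex.Im z * complex.Im w.
Proof. by case: z; case: w. Qed.

Lemma ImM (z w : R[i]) : complex.Im (z * w) =
  complex.Re z * complex.Im w + complex.Im z * complex.Re w.
Proof. by case: z; case: w. Qed.

Lemma ReD (z w : R[i]) : complex.Re (z + w) = complex.Re z + complex.Re w.
Proof. by case: z; case: w. Qed.

Lemma ImD (z w : R[i]) : complex.Im (z + w) = complex.Im z + complex.Im w.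
Proof. by case: z; case: w. Qed.

Lemma cintegrableZ (c : R[i]) F : cintegrable F -> cintegrable (fun x => c * F x).
Proof.
move=> [rF iF]; split.
  rewrite (_ : _ \o _ = fun x => complex.Re c * complex.Re (F x) -
    complex.Im c * complex.Im (F x)); last by apply/funext => x; rewrite /= ReM.
  by apply: integrable_realB; exact: integrable_realZ.
rewrite (_ : _ \o _ = fun x => complex.Re c * complex.Im (F x) +
  complex.Im c * complex.Re (F x)); last by apply/funext => x; rewrite /= ImM.
by apply: integrable_realD; exact: integrable_realZ.
Qed.

Lemma cintegralZ (c : R[i]) F : cintegrable F ->
  cintegral (fun x => c * F x) = c * cintegral F.
Proof.
move=> [rF iF]; rewrite /cintegral.
have -> : Rintegral mu setT (@complex.Re R \o (fun x => c * F x)) =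
    complex.Re c * Rintegral mu setT (@complex.Re R \o F) -
    complex.Im c * Rintegral mu setT (@complex.Im R \o F).
  rewrite -!RintegralZl// -RintegralB//; try exact: integrable_realZ.
  by apply: eq_Rintegral => x _; rewrite /= ReM.
have -> : Rintegral mu setT (@complex.Im R \o (fun x => c * F x)) =
    complex.Re c * Rintegral mu setT (@complex.Im R \o F) +
    complex.Im c * Rintegral mu setT (@complex.Re R \o F).
  rewrite -!RintegralZl// -RintegralD//; try exact: integrable_realZ.
  by apply: eq_Rintegral => x _; rewrite /= ImM.
by case: c.
Qed.

Lemma cintegrableD F G : cintegrable F -> cintegrable G ->
  cintegrable (fun x => F x + G x).
Proof.
move=> [rF iF] [rG iG]; split.
  rewrite (_ : _ \o _ = fun x => complex.Re (F x) + complex.Re (G x)).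
    exact: integrable_realD.
  by apply/funext => x; rewrite /= ReD.
rewrite (_ : _ \o _ = fun x => complex.Im (F x) + complex.Im (G x)).
  exact: integrable_realD.
by apply/funext => x; rewrite /= ImD.
Qed.

Lemma cintegralD F G : cintegrable F -> cintegrable G ->
  cintegral (fun x => F x + G x) = cintegral F + cintegral G.
Proof.
move=> [rF iF] [rG iG]; rewrite /cintegral.
have -> : Rintegral mu setT (@complex.Re R \o (fun x => F x + G x)) =
    Rintegral mu setT (@complex.Re R \o F) + Rintegral mu setT (@complex.Re R \o G).
  by rewrite -RintegralD//; apply: eq_Rintegral => x _; rewrite /= ReD.
have -> : Rintegral mu setT (@complex.Im R \o (fun x => F x + G x)) =
    Rintegral mu setT (@complex.Im R \o F) + Rintegral mu setT (@complex.Im R \o G).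
  by rewrite -RintegralD//; apply: eq_Rintegral => x _; rewrite /= ImD.
by [].
Qed.

Lemma cintegrable0 : cintegrable (fun _ : 'cV[R]_d => 0 : R[i]).
Proof. by split; exact: integrable0. Qed.

Lemma cintegral0 : cintegral (fun _ : 'cV[R]_d => 0 : R[i]) = 0.
Proof.
by rewrite /cintegral [X in X +i* _]Rintegral_cst// [X in _ +i* X]Rintegral_cst// mul0r.
Qed.

Lemma cintegral_sum (I : Type) (s : seq I) (F : I -> 'cV[R]_d -> R[i]) :
  (forall i, cintegrable (F i)) ->
  cintegrable (fun x => \sum_(i <- s) F i x) /\
  cintegral (fun x => \sum_(i <- s) F i x) = \sum_(i <- s) cintegral (F i).
Proof.
move=> iF; elim: s => [|i s [IH1 IH2]].
  rewrite (_ : (fun x => _) = fun=> 0); last by apply/funext => x; rewrite big_nil.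
  by rewrite big_nil cintegral0; split => //; exact: cintegrable0.
rewrite (_ : (fun x => _) = fun x => F i x + \sum_(j <- s) F j x); last first.
  by apply/funext => x; rewrite big_cons.
by rewrite big_cons cintegralD// IH2; split => //; exact: cintegrableD.
Qed.

Lemma cintegral_affine (s : R) (c : 'cV[R]_d) F : 0 < s -> cintegrable F ->
  cintegral (fun x => F (affine_cV s c x)) = (s ^- d)%:C * cintegral F.
Proof.
move=> s0 [rF iF]; rewrite /cintegral.
have -> : Rintegral mu setT (@complex.Re R \o (fun x => F (affine_cV s c x))) =
  s ^- d * Rintegral mu setT (@complex.Re R \o F) by rewrite -(Rintegral_affine s0 c).
have -> : Rintegral mu setT (@complex.Im R \o (fun x => F (affine_cV s c x))) =
  s ^- d * Rintegral mu setT (@complex.Im R \o F) by rewrite -(Rintegral_affine s0 c).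
by apply/eqP; rewrite eq_complex /= !mul0r subr0 addr0 !eqxx.
Qed.

Lemma ae_eq_cintegral F G : cmeasurable F -> cmeasurable G ->
  {ae mu, forall x, F x = G x} -> cintegral F = cintegral G.
Proof.
move=> [rF iF] [rG iG] FG; rewrite /cintegral /Rintegral.
congr (fine _ +i* fine _); apply: ae_eq_integral => //;
  by [exact/measurable_EFinP|apply: filterS FG => x FGx _; rewrite /= FGx].
Qed.

Lemma cintegrable_cmeasurable F : cintegrable F -> cmeasurable F.
Proof.
by move=> [rF iF]; split; apply/measurable_EFinP; [have := measurable_int _ rF|
  have := measurable_int _ iF].
Qed.

Lemma measurable_dotp (xi : 'cV[R]_d) :
  measurable_fun setT (fun x : 'cV[R]_d => dotp x xi).
Proof.
apply: measurable_sum => i; apply: measurable_funM => //.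
exact: measurable_coord_cV.
Qed.

Lemma cintegrable_character (u : 'cV[R]_d -> R) (xi : 'cV[R]_d) :
  mu.-integrable setT (EFin \o u) ->
  cintegrable (fun x => (u x)%:C * expi (- dotp x xi)).
Proof.
move=> iu; have mu_ : measurable_fun setT u.
  by apply/measurable_EFinP; exact: measurable_int iu.
have iun : mu.-integrable setT (EFin \o (fun x => `|u x|)) by exact: integrable_norm.
have mdN : measurable_fun setT (fun x : 'cV[R]_d => - dotp x xi).
  by apply: measurableT_comp => //; exact: measurable_dotp.
split.
  rewrite (_ : @complex.Re R \o _ = fun x => u x * cos (- dotp x xi)); last first.
    by apply/funext => x; rewrite /= mul0r subr0.
  apply: le_integrable_real iun _.
    apply: measurable_funM => //; apply: measurableT_comp mdN.
    apply: continuous_measurable_fun; exact: continuous_cos.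
  move=> x; rewrite normrM ler_piMr//.
  by rewrite ler_norml cos_geN1 cos_le1.
rewrite (_ : @complex.Im R \o _ = fun x => u x * sin (- dotp x xi)); last first.
  by apply/funext => x; rewrite /= mul0r addr0.
apply: le_integrable_real iun _.
  apply: measurable_funM => //; apply: measurableT_comp mdN.
  apply: continuous_measurable_fun; exact: continuous_sin.
move=> x; rewrite normrM ler_piMr//.
by rewrite ler_norml sin_geN1 sin_le1.
Qed.

Lemma fourier_real (u : 'cV[R]_d -> R) (xi : 'cV[R]_d) :
  fourier (fun x => (u x)%:C) xi =
  Rintegral mu setT (fun x => u x * cos (- dotp x xi)) +i*
  Rintegral mu setT (fun x => u x * sin (- dotp x xi)).
Proof.
rewrite /fourier /cintegral; congr (_ +i* _); apply: eq_Rintegral => x _ /=.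
  by rewrite mul0r subr0.
by rewrite mul0r addr0.
Qed.

(** Substitute y = 2x - k, so that x.xi = (y + k).(xi/2). *)
Lemma fourier_affine (u : 'cV[R]_d -> R) (k xi : 'cV[R]_d) :
  mu.-integrable setT (EFin \o u) ->
  cintegral (fun x => (u (affine_cV 2 (- k) x))%:C * expi (- dotp x xi)) =
  2 ^- d * (expi (- dotp k (2^-1 *: xi)) * fourier (fun x => (u x)%:C) (2^-1 *: xi)).
Proof.
move=> iu; have iF := cintegrable_character (2^-1 *: xi) iu.
pose F x := expi (- dotp k (2^-1 *: xi)) * ((u x)%:C * expi (- dotp x (2^-1 *: xi))).
rewrite [LHS](_ : _ = cintegral (fun x => F (affine_cV 2 (- k) x))); last first.
  congr cintegral; apply/funext => x; rewrite /F mulrCA -expiD; congr (_ * expi _).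
  rewrite -opprD -dotpDl /affine_cV addrCA subrr addr0 dotpZl dotpZr mulrA.
  by rewrite divff ?mul1r// pnatr_eq0.
rewrite cintegral_affine//; last exact: cintegrableZ.
by rewrite cintegralZ// fmorphV rmorphXn rmorph_nat.
Qed.

(** Dominated convergence with bound |u|, applied to the cosine and sine parts separately. *)
Lemma fourier_dilate_cvg1 (u : 'cV[R]_d -> R) (xi : 'cV[R]_d) :
  mu.-integrable setT (EFin \o u) -> Rintegral mu setT u = 1 ->
  fourier (fun x => (u x)%:C) (2 ^- N *: xi) @[N --> \oo] --> (1 : R[i]).
Proof.
move=> iu u1; have mu_ : measurable_fun setT u.
  by apply/measurable_EFinP; exact: measurable_int iu.
have iun : mu.-integrable setT (EFin \o (fun x => `|u x|)) by exact: integrable_norm.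
under eq_fun do rewrite fourier_real.
have key (g : R -> R) : continuous g -> (forall t, `|g t| <= 1) ->
    Rintegral mu setT (fun x => u x * g (- dotp x (2 ^- N *: xi))) @[N --> \oo]
    --> Rintegral mu setT (fun x => u x * g 0).
  move=> cg g1.
  have mg N : measurable_fun setT (fun x => (u x * g (- dotp x (2 ^- N *: xi)))%:E).
    apply/measurable_EFinP; apply: measurable_funM => //.
    apply: measurableT_comp; first exact: continuous_measurable_fun.
    by apply: measurableT_comp => //; exact: measurable_dotp.
  have mf : measurable_fun setT (fun x => (u x * g 0)%:E).
    by apply/measurable_EFinP; apply: measurable_funM.
  have h0 : {ae mu, forall x, setT x ->
      (u x * g (- dotp x (2 ^- N *: xi)))%:E @[N --> \oo] --> (u x * g 0)%:E}.
    apply: aeW => x _; apply: cvg_EFin; first by near=> N.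
    apply: cvgM; first exact: cvg_cst.
    have arg0 : - dotp x (2 ^- N *: xi) @[N --> \oo] --> (0 : R).
      rewrite (_ : (fun N => _) = fun N => - dotp x xi * 2^-1 ^+ N); last first.
        by apply/funext => N; rewrite dotpZr exprVn mulNr mulrC.
      rewrite -[X in _ --> X](mulr0 (- dotp x xi)); apply: cvgM; first exact: cvg_cst.
      by apply: cvg_expr; rewrite ger0_norm ?invr_ge0// invf_lt1// ltr1n.
    exact: (cvg_comp _ _ arg0 (cg 0)).
  have hF : {ae mu, forall x N, setT x ->
      (`|(u x * g (- dotp x (2 ^- N *: xi)))%:E| <= (EFin \o (fun x => `|u x|)%R) x)%E}.
    by apply: aeW => x N _; rewrite /= lee_fin normrM ler_piMr.
  have [fi _ H] := dominated_convergence measurableT mg mf h0 iun hF.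
  apply: fine_cvg; rewrite fineK//; exact: integrable_fin_num.
have kc := key cos (@continuous_cos R) _; have ks := key sin (@continuous_sin R) _.
rewrite (_ : 1 = (1 +i* 0 : R[i]))//; apply: cvg_complex.
  rewrite -[X in _ --> X]u1 (@eq_Rintegral _ _ _ mu setT (fun x => u x * cos 0)).
    by apply: kc => t; rewrite ler_norml cos_geN1 cos_le1.
  by move=> x _; rewrite cos0 mulr1.
have -> : 0 = Rintegral mu setT (fun x => u x * sin 0).
  rewrite (@eq_Rintegral _ _ _ mu setT (fun=> 0)); last by move=> x _; rewrite sin0 mulr0.
  by rewrite Rintegral_cst// mul0r.
by apply: ks => t; rewrite ler_norml sin_geN1 sin_le1.
Unshelve. all: by end_near. Qed.

End complex_integrals.

(** * The product formula for the transform of the box spline *)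

Section sinc.
Context {R : realType}.

(** The Fourier transform of the indicator of [0,1]. *)
Definition sinc_hat (t : R) : R[i] :=
  if t == 0 then 1 else (1 - expi (- t)) / (0 +i* t).

(** With z = exp(-it/2), this is 1 - z^2 = (1 + z)(1 - z). *)
Lemma sinc_hat_half (t : R) :
  sinc_hat t = 2^-1 * (1 + expi (- (2^-1 * t))) * sinc_hat (2^-1 * t).
Proof.
rewrite /sinc_hat mulf_eq0 invr_eq0 pnatr_eq0 /=.
have [->|t0] := eqVneq t 0.
  by rewrite mulr0 oppr0 expi0 mulr1 mulVf// -(natrD _ 1 1) pnatr_eq0.
have -> : 0 +i* (2^-1 * t) = 2^-1 * (0 +i* t) :> R[i].
  rewrite -[2^-1 : R[i]](_ : (2^-1)%:C = _); last by rewrite fmorphV rmorph_nat.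
  by apply/eqP; rewrite eq_complex /= !mulr0 mul0r subr0 addr0 !eqxx.
have -> : expi (- t) = expi (- (2^-1 * t)) ^+ 2.
  by rewrite expr2 -expiD -opprD; congr (expi (- _)); lra.
have it0 : 0 +i* t != 0 :> R[i] by rewrite eq_complex /= negb_and t0 orbT.
by field; exact: it0.
Qed.

Lemma derive_quotient_cvg (f : R -> R) (l : R) (u : nat -> R) :
  is_derive (0 : R) (1 : R) f l -> u N @[N --> \oo] --> (0 : R) -> (forall N, u N != 0) ->
  (f (u N) - f 0) / u N @[N --> \oo] --> l.
Proof.
move=> df u0 un0.
have Hl : h^-1 *: ((f \o shift 0) (h *: (1 : R)) - f 0) @[h --> (0 : R)^'] --> l.
  rewrite -(@derive_val _ _ _ _ _ _ _ df).
  exact: (@ex_derive _ _ _ _ _ _ _ df).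
have : u N @[N --> \oo] --> (0 : R)^'.
  move=> A /= A0; have : \forall N \near \oo, u N != 0 -> A (u N) by exact: (u0 _ A0).
  by apply: filterS => N; apply.
move=> /cvg_comp /(_ Hl); apply: cvg_trans; apply: near_eq_cvg.
apply: nearW => N /=; rewrite addr0 /GRing.scale/= mulr1 mulrC.
by rewrite mulrC.
Qed.

(** The quotient is sin u / u + i (cos u - 1) / u, whose parts tend to the derivatives of sine and
    cosine at 0. *)
Lemma sinc_hat_cvg1 (t : R) : sinc_hat (2 ^- N * t) @[N --> \oo] --> (1 : R[i]).
Proof.
have [->|t0] := eqVneq t 0.
  rewrite (_ : (fun N => _) = fun=> 1); first exact: cvg_cst.
  by apply/funext => N; rewrite mulr0 /sinc_hat eqxx.
pose u N : R := 2 ^- N * t.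
have un0 N : u N != 0 by rewrite mulf_neq0// invr_neq0// expf_neq0// pnatr_eq0.
have u0 : u N @[N --> \oo] --> 0.
  rewrite (_ : (fun N => u N) = fun N => t * 2^-1 ^+ N); last first.
    by apply/funext => N; rewrite exprVn mulrC.
  rewrite -[X in _ --> X](mulr0 t); apply: cvgM; first exact: cvg_cst.
  by apply: cvg_expr; rewrite ger0_norm ?invr_ge0// invf_lt1// ltr1n.
rewrite (_ : (fun N => _) = fun N =>
    ((sin (u N) - sin 0) / u N) +i* ((cos (u N) - cos 0) / u N)); last first.
  apply/funext => N; rewrite /sinc_hat (negbTE (un0 N)) /expi cosN sinN sin0 cos0.
  apply: (mulIf (_ : 0 +i* u N != 0)); first by rewrite eq_complex /= negb_and un0 orbT.
  rewrite divfK; last by rewrite eq_complex /= negb_and un0 orbT.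
  apply/eqP; rewrite eq_complex /= !mulr0 add0r addr0 !divfK// opprK.
  by rewrite subr0 opprB add0r !eqxx.
rewrite (_ : 1 = 1 +i* 0)//; apply: cvg_complex.
  apply: derive_quotient_cvg => //.
  by have := is_derive_sin (0 : R); rewrite cos0.
apply: derive_quotient_cvg => //.
by have := is_derive_cos (0 : R); rewrite sin0 oppr0.
Qed.

End sinc.

Section fourier_box_spline.
Context {R : realType}.
Variables (d n s : nat) (P : 'M[int]_(d, n)) (g1 g2 : 'I_s -> 'cV[int]_n).
Hypothesis P2 : [set P^T *m k | k in ~` even_lattice d] `<=` ~` even_lattice n.
Hypothesis dn : (d <= n)%N.
Hypothesis gP : enumerates_pairs g1 g2.
Local Notation mu := (@lebesgue_cV R d).
Local Notation M := (@box_spline R d n P).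
Local Notation phi := (fun x => (M x)%:C).
Local Notation mask := (fourier_series (project P (haar n))).

Let iM : mu.-integrable setT (EFin \o M).
Proof. exact: integrable_box_spline. Qed.

Let iMa (k : 'cV[int]_d) : mu.-integrable setT (EFin \o (fun x => M (affine_cV 2 (- intcV k) x))).
Proof. by have := integrable_affine (ltr0Sn R 1) (- intcV k) iM. Qed.

(** The mask is an average of 2^n numbers of modulus 1. *)
Lemma norm_mask_le1 (xi : 'cV[R]_d) : `|mask xi| <= 1.
Proof.
rewrite fourier_project_haar normrM.
have n0 : (0 : R[i]) < 2 ^+ n by rewrite exprn_gt0.
rewrite ger0_norm ?invr_ge0 ?(ltW n0)// mulrC ler_pdivrMr// mul1r.
apply: le_trans (ler_norm_sum _ _ _) _.
rewrite (eq_bigr (fun=> 1)); last by move=> e _; rewrite norm_expi.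
by rewrite sumr_const card_ffun card_bool card_ord natrX.
Qed.

Let real_complex_const : ((2 ^+ d * 2 ^- n : R)%:C = 2 ^+ d * 2 ^- n :> R[i]).
Proof. by rewrite rmorphM/= fmorphV !rmorphXn /= !rmorph_nat. Qed.

Let d0 : (2 ^+ d : R[i]) != 0.
Proof. by rewrite expf_neq0// pnatr_eq0. Qed.

Lemma fourier_box_spline_refine (xi : 'cV[R]_d) :
  fourier phi xi = mask (2^-1 *: xi) * fourier phi (2^-1 *: xi).
Proof.
pose G (e : {ffun 'I_n -> bool}) x :=
  (2 ^+ d * 2 ^- n : R[i]) * ((M (affine_cV 2 (- intcV (P *m bitcV e)) x))%:C *
     expi (- dotp x xi)).
have iG e : cintegrable (G e) by apply: cintegrableZ; exact: cintegrable_character.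
have [iS IS] := cintegral_sum (index_enum {ffun 'I_n -> bool}) iG.
transitivity (cintegral (fun x => \sum_e G e x)).
  apply: ae_eq_cintegral.
  - by apply: cintegrable_cmeasurable; exact: cintegrable_character.
  - exact: cintegrable_cmeasurable.
  apply: filterS (box_spline_refine P2 dn) => x ->.
  rewrite rmorphM/= real_complex_const rmorph_sum/= -mulrA big_distrl/= big_distrr/=.
  by apply: eq_bigr => e _.
rewrite IS fourier_project_haar -mulrA big_distrl/= big_distrr/=.
apply: eq_bigr => e _; rewrite cintegralZ; last exact: cintegrable_character.
by rewrite fourier_affine// [2 ^+ d * _]mulrC -mulrA mulVKf.
Qed.

Lemma integrable_framelet l : mu.-integrable setT (EFin \o framelet P g1 g2 l).
Proof. by apply: integrable_realZ; exact: integrable_realB. Qed.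

Lemma fourier_framelet l (xi : 'cV[R]_d) :
  fourier (fun x => (framelet P g1 g2 l x)%:C) xi =
  fourier_series (project P (edge_filter (g1 l) (g2 l))) (2^-1 *: xi) *
  fourier phi (2^-1 *: xi).
Proof.
have [_ _ g12] := gP.1 l; rewrite fourier_project_edge//.
pose F (k : 'cV[int]_n) x :=
  (M (affine_cV 2 (- intcV (P *m k)) x))%:C * expi (- dotp x xi).
have iF k : cintegrable (F k) by exact: cintegrable_character.
rewrite /fourier [LHS](_ : _ = cintegral (fun x => 2 ^+ d * 2 ^- n * F (g1 l) x +
    - (2 ^+ d * 2 ^- n) * F (g2 l) x)); last first.
  congr cintegral; apply/funext => x; rewrite /framelet rmorphM/= real_complex_const.
  by rewrite rmorphB/= /F; ring.
rewrite cintegralD; try exact: cintegrableZ.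
rewrite !cintegralZ// !fourier_affine// -/(fourier _ _).
by field; rewrite !expf_neq0// pnatr_eq0.
Qed.

Lemma box_spline_hatE (xi : 'cV[R]_d) : box_spline_hat (map_mx intr P) xi =
  \prod_(j < n) sinc_hat (((map_mx intr P)^T *m xi) j 0).
Proof.
apply: eq_bigr => j _; rewrite /sinc_hat.
have -> // : dotp (col j (map_mx intr P)) xi = ((map_mx intr P)^T *m xi) j 0.
by rewrite mxE; apply: eq_bigr => i _; rewrite !mxE.
Qed.

(** Halving every factor splits off the product of the (1 + exp(-i th/2)) / 2, and expanding this
    product over bit vectors gives the mask. *)
Lemma box_spline_hat_refine (xi : 'cV[R]_d) : box_spline_hat (map_mx intr P) xi =
  mask (2^-1 *: xi) * box_spline_hat (map_mx intr P) (2^-1 *: xi).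
Proof.
rewrite !box_spline_hatE fourier_project_haar.
pose th j := ((map_mx intr P)^T *m xi) j 0.
have thE j : ((map_mx intr P)^T *m (2^-1 *: xi)) j 0 = 2^-1 * th j.
  by rewrite -scalemxAr mxE.
under eq_bigr do rewrite sinc_hat_half.
under [X in _ = _ * X]eq_bigr do rewrite thE.
rewrite !big_split/= prodr_const card_ord exprVn; congr (_ * _ * _).
rewrite -sum_bits_prod; apply: eq_bigr => e _.
rewrite intcV_dotp /dotp -sumrN expi_sum; apply: eq_bigr => j _.
rewrite thE /intcV ![in RHS]mxE; case: (e j).
  by rewrite mulr1n mulr1z mul1r.
by rewrite mulr0n mulr0z mul0r oppr0 expi0.
Qed.

Lemma box_spline_hat_cvg1 (xi : 'cV[R]_d) :
  box_spline_hat (map_mx intr P) (2 ^- N *: xi) @[N --> \oo] --> (1 : R[i]).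
Proof.
under eq_fun do rewrite box_spline_hatE.
suff : \prod_(j < n) sinc_hat (((map_mx intr P)^T *m (2 ^- N *: xi)) j 0)
    @[N --> \oo] --> \prod_(j < n) (1 : R[i]) by rewrite big1_eq.
apply: cvg_big => // [|j _]; first exact: mul_continuous.
under eq_fun do rewrite -scalemxAr mxE.
exact: sinc_hat_cvg1.
Qed.

Lemma mask_product_cvg (xi : 'cV[R]_d) :
  \prod_(1 <= j < N.+1) mask ((2 ^- j) *: xi) @[N --> \oo] --> fourier phi xi.
Proof.
apply: refinable_infinite_product; first exact: norm_mask_le1.
- exact: fourier_box_spline_refine.
- by apply: fourier_dilate_cvg1 => //; exact: Rintegral_box_spline.
Qed.

(* Both sides are the limit of the same infinite product. *)
Lemma fourier_box_spline (xi : 'cV[R]_d) :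
  fourier phi xi = box_spline_hat (map_mx intr P) xi.
Proof.
have H : \prod_(1 <= j < N.+1) mask ((2 ^- j) *: xi) @[N --> \oo] -->
    box_spline_hat (map_mx intr P) xi.
  apply: refinable_infinite_product; first exact: norm_mask_le1.
  - exact: box_spline_hat_refine.
  - exact: box_spline_hat_cvg1.
exact: cvg_unique (@mask_product_cvg xi) H.
Qed.

End fourier_box_spline.

(** * Compact supports *)

Section compact_support.
Context {R : realType}.
Variable d : nat.

Lemma continuous_trmx_rV : continuous (fun v : 'rV[R]_d => v^T : 'cV[R]_d).
Proof.
move=> v A /= /nbhs_ballP[e e0 eA]; apply/nbhs_ballP; exists e => //= v' [e1 vv'].
by apply: eA; split => // i j; rewrite !mxE; exact: vv'.
Qed.

Lemma compact_box_cV (a b : 'I_d -> R) : compact (box_cV a b).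
Proof.
have cr : compact [set v : 'rV[R]_d | forall i, `[a i, b i]%classic (v ord0 i)].
  apply: (@rV_compact _ _ (fun i => `[a i, b i]%classic)) => i.
  exact: segment_compact.
rewrite (_ : box_cV a b = (fun v : 'rV[R]_d => v^T) @`
    [set v : 'rV[R]_d | forall i, `[a i, b i]%classic (v ord0 i)]).
  by apply: continuous_compact cr; apply: continuous_subspaceT; exact: continuous_trmx_rV.
apply/seteqP; split => [x xab|_ [v vab <-] i]; last by rewrite mxE; exact: vab.
by exists x^T; [move=> i /=; rewrite mxE; exact: xab|rewrite trmxK].
Qed.

Lemma closed_box_cV (a b : 'I_d -> R) : closed (box_cV a b).
Proof. by apply: compact_closed; [exact: norm_hausdorff|exact: compact_box_cV]. Qed.

Lemma compactly_supported_box (f : 'cV[R]_d -> R[i]) (a b : 'I_d -> R) :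
  [set x | f x != 0] `<=` box_cV a b -> compactly_supported f.
Proof.
move=> fab; apply: (subclosed_compact (@closed_closure _ _) (@compact_box_cV a b)).
rewrite [X in _ `<=` X]((closure_id _).1 (@closed_box_cV a b)).
exact: closureS.
Qed.

End compact_support.

Section complex_square_integrable.
Context {R : realType}.
Variable d : nat.
Local Notation mu := (@lebesgue_cV R d).
Implicit Types (f : 'cV[R]_d -> R[i]) (u : 'cV[R]_d -> R).

Local Notation re f := (@complex.Re R \o f).
Local Notation im f := (@complex.Im R \o f).

Lemma normc_sqr (z : R[i]) :
  Normc.normc z ^+ 2 = complex.Re z ^+ 2 + complex.Im z ^+ 2.
Proof. by case: z => a b; rewrite /= sqr_sqrtr// addr_ge0// sqr_ge0. Qed.

Lemma sq_integrable_parts f : square_integrable f ->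
  [/\ sq_integrable mu (re f), sq_integrable mu (im f) &
    L2_sqnorm f = ((sqnorm mu (re f))%:E + (sqnorm mu (im f))%:E)%E].
Proof.
move=> [[mr mi] foo].
have L2E : L2_sqnorm f =
    (\int[mu]_x ((re f x) ^+ 2)%:E + \int[mu]_x ((im f x) ^+ 2)%:E)%E.
  rewrite -ge0_integralD//.
  - by apply: eq_integral => x _; rewrite normc_sqr EFinD.
  - by move=> x _; rewrite lee_fin sqr_ge0.
  - by apply/measurable_EFinP; exact: measurable_funX.
  - by move=> x _; rewrite lee_fin sqr_ge0.
  - by apply/measurable_EFinP; exact: measurable_funX.
have sq u : measurable_fun setT u -> (\int[mu]_x (u x ^+ 2)%:E < +oo)%E ->
    sq_integrable mu u.
  move=> mu_ uoo; split => //; apply/integrableP; split.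
    by apply/measurable_EFinP; exact: measurable_funX.
  by under eq_integral do rewrite /= ger0_norm ?sqr_ge0//.
have int0 u : (0 <= \int[mu]_x (u x ^+ 2)%:E)%E.
  by apply: integral_ge0 => x _; rewrite lee_fin sqr_ge0.
have r2 : sq_integrable mu (re f).
  by apply: sq => //; apply: le_lt_trans foo; rewrite L2E leeDl// int0.
have i2 : sq_integrable mu (im f).
  by apply: sq => //; apply: le_lt_trans foo; rewrite L2E leeDr// int0.
by split => //; rewrite L2E !sqnormE.
Qed.

Lemma square_integrable_real u : sq_integrable mu u ->
  square_integrable (fun x => (u x)%:C).
Proof.
move=> [mu_ iu]; split.
  by split => //; exact: (measurable_cst (0 : R)).
rewrite /L2_sqnorm (eq_integral (fun x => (u x ^+ 2)%:E)); last first.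
  by move=> x _; rewrite normc_sqr /= expr0n addr0.
exact: (integrable_lty measurableT iu).
Qed.

(** Pairing with a real function does not mix real and imaginary parts, so every energy of a complex
    function is a sum of two real ones. *)
Lemma normc_inner_real f u :
  Normc.normc (inner f (fun x => (u x)%:C)) ^+ 2 =
  Rintegral mu setT (fun x => re f x * u x) ^+ 2 +
  Rintegral mu setT (fun x => im f x * u x) ^+ 2.
Proof.
rewrite normc_sqr /inner /cintegral /=.
congr (_ ^+ 2 + _ ^+ 2); apply: eq_Rintegral => x _ /=; case: (f x) => a b /=;
  by rewrite oppr0 mulr0 ?subr0 ?add0r.
Qed.

End complex_square_integrable.

(** * The tight framelet *)

Section tight_framelet.
Context {R : realType}.
Variables (d n s : nat) (P : 'M[int]_(d, n)) (g1 g2 : 'I_s -> 'cV[int]_n).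
Hypothesis P2 : [set P^T *m k | k in ~` even_lattice d] `<=` ~` even_lattice n.
Hypothesis dn : (d <= n)%N.
Hypothesis gP : enumerates_pairs g1 g2.
Local Notation mu := (@lebesgue_cV R d).
Local Notation M := (@box_spline R d n P).
Local Notation phi := (fun x => (M x)%:C).
Local Notation psi l := (fun x => (@framelet R d n s P g1 g2 l x)%:C).

Lemma compactly_supported_box_spline : compactly_supported phi.
Proof.
apply: (@compactly_supported_box _ _ _ (fun i => - box_radius P i) (box_radius P)).
move=> x /= Mx; apply: box_spline_support; apply: contra Mx => /eqP ->.
by rewrite eqxx.
Qed.

Lemma compactly_supported_framelet l : compactly_supported (psi l).
Proof.
(* Where a term of the framelet is nonzero, 2x minus its shift lies in the support box; adding both
   shifts gives one radius valid for either term. *)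
pose r i : R := `|(P *m g1 l) i ord0|%:~R + `|(P *m g2 l) i ord0|%:~R + @box_radius R _ _ P i.
apply: (@compactly_supported_box _ _ _ (fun i => - r i) r) => x /= psix i.
have box (k : 'cV[int]_d) : M (affine_cV 2 (- intcV k) x) != 0 ->
    `|x i 0| <= `|k i 0|%:~R + box_radius P i.
  move=> /box_spline_support/(_ i); rewrite in_itv/= -ler_norml !mxE => h.
  have : `|2 * x i 0| <= box_radius P i + `|(k i 0)%:~R|.
    rewrite -[2 * x i 0](subrK (k i 0)%:~R); apply: le_trans (ler_normD _ _) _.
    by rewrite lerD2r.
  rewrite normrM ger0_norm// intr_norm; have := normr_ge0 (x i 0); lra.
have p1 : 0 <= `|(P *m g1 l) i 0|%:~R :> R by rewrite ler0z.
have p2 : 0 <= `|(P *m g2 l) i 0|%:~R :> R by rewrite ler0z.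
rewrite in_itv/= -ler_norml /r.
have [M1|/box h] := eqVneq (M (affine_cV 2 (- intcV (P *m g1 l)) x)) 0; last lra.
have [M2|/box h] := eqVneq (M (affine_cV 2 (- intcV (P *m g2 l)) x)) 0; last lra.
by move: psix; rewrite /framelet M1 M2 subrr mulr0 eqxx.
Qed.

Let sqM : sq_integrable mu M.
Proof.
have <- : scaled_translate M 0 (0 : 'cV[int]_d) = M.
  apply/funext => x.
  by rewrite /scaled_translate /affine_cV expr0 scale1r intcV0 subr0.
exact: (sq_integrable_scaled_translate (measurable_box_spline P2 dn)
  (box_spline_ge0 P2 dn) (box_spline_le1 P2 dn) (integrable_box_spline P2 dn)).
Qed.

Lemma square_integrable_box_spline : square_integrable phi.
Proof. exact: square_integrable_real. Qed.

Lemma square_integrable_framelet l : square_integrable (psi l).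
Proof.
have sqMa (k : 'cV[int]_d) : sq_integrable mu (fun x => M (affine_cV 2 (- intcV k) x)).
  have [mM iM] := sqM; split.
    exact: (measurableT_comp mM (measurable_affine_cV _ _)).
  by have := integrable_affine (ltr0Sn R 1) (- intcV k) iM.
by apply: square_integrable_real; apply: sq_integrableZ; exact: sq_integrableB.
Qed.

Lemma energy_box_spline (f : 'cV[R]_d -> R[i]) :
  (\esum_(k in [set: 'cV[int]_d])
     (Normc.normc (inner f (fun x => (M (x - intcV k))%:C)) ^+ 2)%:E =
   sampled_energy M 0 (@complex.Re R \o f) +
   sampled_energy M 0 (@complex.Im R \o f))%E.
Proof.
have p0 (z : R) : (0 <= ((2 ^+ 0) ^+ d * z ^+ 2)%:E)%E.
  by rewrite lee_fin mulr_ge0 ?sqr_ge0// !exprn_ge0.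
rewrite -esumD//; apply: eq_esum => k _.
rewrite normc_inner_real -EFinD expr0 expr1n !mul1r /coef; congr EFin.
by congr (_ ^+ 2 + _ ^+ 2); apply: eq_Rintegral => x _;
  rewrite /scaled_translate /affine_cV expr0 scale1r.
Qed.

Lemma powR_half_sqr (m : nat) : (2 `^ (m%:R / 2)) ^+ 2 = 2 ^+ m :> R.
Proof. by rewrite -powR_mulrn ?powR_ge0// -powRrM divfK ?pnatr_eq0// powR_mulrn. Qed.

Lemma energy_framelet (f : 'cV[R]_d -> R[i]) j l : square_integrable f ->
  (\esum_(k in [set: 'cV[int]_d])
     (Normc.normc (inner f (dilate_shift (psi l) j k)) ^+ 2)%:E =
   framelet_energy P g1 g2 j l (@complex.Re R \o f) +
   framelet_energy P g1 g2 j l (@complex.Im R \o f))%E.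
Proof.
move=> f2; have [r2 i2 _] := sq_integrable_parts f2.
have p0 (z : R) : (0 <= ((2 ^+ j) ^+ d * z ^+ 2)%:E)%E.
  by rewrite lee_fin mulr_ge0 ?sqr_ge0// !exprn_ge0.
rewrite -esumD//; apply: eq_esum => k _.
pose c : R := 2 `^ ((j * d)%:R / 2).
have -> : dilate_shift (psi l) j k =
    fun x => (c * framelet P g1 g2 l (affine_cV (2 ^+ j) (- intcV k) x))%:C.
  by apply/funext => x; rewrite [RHS]rmorphM.
(* The squared normalisation of the dilated framelet is the weight in [framelet_energy]. *)
have c2 : c ^+ 2 = (2 ^+ j) ^+ d by rewrite powR_half_sqr exprM.
have sqw : sq_integrable mu (fun x => framelet P g1 g2 l (affine_cV (2 ^+ j) (- intcV k) x)).
  have [[mw' iw'] _ _] := sq_integrable_parts (square_integrable_framelet l).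
  split; first by apply: (measurableT_comp mw'); exact: measurable_affine_cV.
  have j0 : 0 < 2 ^+ j :> R by rewrite exprn_gt0.
  by have := integrable_affine j0 (- intcV k) iw'.
have H (u : 'cV[R]_d -> R) : sq_integrable mu u ->
    Rintegral mu setT (fun x => u x * (c * framelet P g1 g2 l (affine_cV (2 ^+ j) (- intcV k) x))) =
    c * framelet_coef P g1 g2 u l j k.
  move=> u2; rewrite -RintegralZl//; last exact: integrableM_sq.
  by apply: eq_Rintegral => x _; rewrite mulrCA.
by rewrite normc_inner_real !H// !exprMn c2 -EFinD.
Qed.

Theorem tight_framelet_box_spline :
  tight_framelet phi (fun l => psi l).
Proof.
split; [exact: square_integrable_box_spline|exact: square_integrable_framelet|].
move=> f f2; have [r2 i2 ->] := sq_integrable_parts f2.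
have ge0 j l u : (0 <= framelet_energy P g1 g2 j l u)%E by exact: framelet_energy_ge0.
rewrite energy_box_spline (framelet_energy_sum P2 dn gP r2).
rewrite (framelet_energy_sum P2 dn gP i2) addeACA; congr (_ + _)%E.
rewrite -nneseriesD; last 2 first.
- by move=> j _ _; apply: sume_ge0 => l _.
- by move=> j _ _; apply: sume_ge0 => l _.
apply: eq_eseriesr => j _; rewrite -big_split/=; apply: eq_bigr => l _.
by rewrite energy_framelet.
Qed.

End tight_framelet.

Theorem theorem2 (R : realType) (d n : nat) (P : 'M[int]_(d, n))
    (g1 g2 : 'I_('C(2 ^ n, 2)) -> 'cV[int]_n) :
  (1 <= d)%N -> (d <= n)%N ->
  \rank (map_mx intr P : 'M[R]_(d, n)) = d ->
  [set P^T *m k | k in ~` even_lattice d] `<=` ~` even_lattice n ->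
  enumerates_pairs g1 g2 ->
  let Pa : zfilter R d := project P (haar n) in
  let Pb (l : 'I_('C(2 ^ n, 2))) : zfilter R d :=
    project P (edge_filter (g1 l) (g2 l)) in
  [/\ tight_framelet_filter_bank Pa Pb,
      Pa = box_spline_filter P &
      forall l, (exists j, Pb l j != 0) -> directional (Pb l)] /\
  (exists (phi : 'cV[R]_d -> R[i])
          (psi : 'I_('C(2 ^ n, 2)) -> 'cV[R]_d -> R[i]),
    [/\ cintegrable phi /\
        (forall xi : 'cV[R]_d,
          \prod_(1 <= j < N.+1) fourier_series Pa ((2 ^- j) *: xi)
            @[N --> \oo] --> fourier phi xi),
        (forall l, has_fourier (psi l) (fun xi : 'cV[R]_d =>
          fourier_series (Pb l) (2^-1 *: xi) * fourier phi (2^-1 *: xi))),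
        (compactly_supported phi /\ square_integrable phi) /\
        (forall l, compactly_supported (psi l) /\ square_integrable (psi l)),
        tight_framelet phi psi &
        is_box_spline (map_mx intr P) phi]).
Proof.
move=> _ dn _ P2 gP Pa Pb; have [g01 _] := gP.
split.
  split => //; first exact: tight_filter_bank_project.
  by move=> l; apply: directional_project_edge; have [] := g01 l.
exists (fun x => (@box_spline R d n P x)%:C),
  (fun l x => (@framelet R d n _ P g1 g2 l x)%:C).
have cphi : cintegrable (fun x => (@box_spline R d n P x)%:C).
  by split; [exact: integrable_box_spline|exact: integrable0].
split.
- by split => // xi; exact: mask_product_cvg.
- move=> l; split; last by move=> xi; exact: fourier_framelet.
  by split; [exact: integrable_framelet|exact: integrable0].
- split.
    by split; [exact: compactly_supported_box_spline|exact: square_integrable_box_spline].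
  by move=> l; split; [exact: compactly_supported_framelet|exact: square_integrable_framelet].
- exact: tight_framelet_box_spline.
- by split => // xi; exact: fourier_box_spline.
Qed.
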